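(* Let $(A,\mathfrak{m})$ be a Noetherian local ring and let $I \subseteq J \subseteq \mathfrak{m}$ be ideals of $A$ with $\ell(J/I) < \infty$. Set $\mathcal{R} = A[It]$ and $\mathcal{S} = A[Jt]$. Suppose that for all $i \geq 0$ we have $H^i_{\mathcal{R}_+}(\mathcal{S})_n = 0$ for all $n \gg 0$. Then $J \subseteq \overline{I}$.
   Context: Rings are commutative with identity. $\ell(-)$ denotes length as an $A$-module. For an ideal $K$ of $A$, $A[Kt] = \bigoplus_{n\ge 0} K^n t^n \subseteq A[t]$ is the Rees algebra of $K$, graded by degree in $t$. $\mathcal{R}_+ = \bigoplus_{n \ge 1} I^n t^n$. Since $I \subseteq J$, $\mathcal{R}$ is a graded subring of $\mathcal{S}$, and $\mathcal{S}$ is regarded as a graded $\mathcal{R}$-module. $H^i_{\mathcal{R}_+}(-)$ denotes the $i$-th local cohomology functor of $\mathcal{R}$-modules with support in $\mathcal{R}_+$; for a graded module it is naturally $\mathbb{Z}$-graded, and $H^i_{\mathcal{R}_+}(-)_n$ is its degree $n$ component. ''For all $n \gg 0$'' means for all sufficiently large $n$. $\overline{I}$ denotes the integral closure of the ideal $I$ in $A$. *)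

(* Defs.v *)
From HB Require Import structures.
From mathcomp Require Import all_boot all_order all_algebra.
From mathcomp Require Import boolp classical_sets.

Set Implicit Arguments.
Unset Strict Implicit.
Unset Printing Implicit Defensive.

Import GRing.Theory.
Local Open Scope classical_set_scope.
Local Open Scope ring_scope.

(* Ideals are not required to be proper (mathcomp's idealr_closed excludes
   the unit ideal, which occurs below as I ^ 0). *)
Record ideal (R : comNzRingType) := Ideal {
  ideal_mem :> R -> Prop;
  ideal0 : ideal_mem 0;
  idealD : forall x y, ideal_mem x -> ideal_mem y -> ideal_mem (x + y);
  idealM : forall a x, ideal_mem x -> ideal_mem (a * x) }.

Definition ideal_set (R : comNzRingType) (I : ideal R) : set R := ideal_mem I.
Coercion ideal_set : ideal >-> set.

Section IdealTheory.
Variable R : comNzRingType.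
Implicit Types I J : ideal R.

Lemma ideal_sum I (T : eqType) (s : seq T) (f : T -> R) :
  (forall t, t \in s -> I (f t)) -> I (\sum_(t <- s) f t).
Proof.
move=> h; rewrite big_seq.
by elim/big_ind: _ => //; [exact: ideal0 | exact: idealD].
Qed.

Definition ideal_unit : ideal R :=
  @Ideal R [set: R] Logic.I (fun _ _ _ _ => Logic.I) (fun _ _ _ => Logic.I).

Definition mul_set I J : set R := [set x | exists s : seq (R * R),
  (forall p, p \in s -> I p.1 /\ J p.2) /\ x = \sum_(p <- s) p.1 * p.2].

Lemma mul_set0 I J : mul_set I J 0.
Proof. by exists [::]; rewrite big_nil. Qed.

Lemma mul_setD I J x y :
  mul_set I J x -> mul_set I J y -> mul_set I J (x + y).
Proof.
move=> [s [hs ->]] [t [ht ->]]; exists (s ++ t); rewrite big_cat; split=> //.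
by move=> p; rewrite mem_cat => /orP[/hs|/ht].
Qed.

Lemma mul_setM I J a x : mul_set I J x -> mul_set I J (a * x).
Proof.
move=> [s [hs ->]]; exists [seq (a * p.1, p.2) | p <- s]; split.
  by move=> _ /mapP[p /hs[h1 h2] ->]; split=> //=; exact: idealM.
by rewrite big_map mulr_sumr; apply: eq_bigr => p _; rewrite mulrA.
Qed.

Definition ideal_mul I J : ideal R :=
  Ideal (mul_set0 I J) (@mul_setD I J) (@mul_setM I J).

Definition ideal_exp I (n : nat) : ideal R := iter n (ideal_mul I) ideal_unit.

Lemma ideal_mulI I J x y : I x -> J y -> ideal_mul I J (x * y).
Proof.
move=> Ix Jy; exists [:: (x, y)]; rewrite big_seq1; split=> // p.
by rewrite inE => /eqP ->.
Qed.

Lemma ideal_expD I m n x y :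
  ideal_exp I m x -> ideal_exp I n y -> ideal_exp I (m + n) (x * y).
Proof.
elim: m x => [|m IHm] x; first by move=> _; exact: idealM.
move=> [s [hs ->]] hy; rewrite mulr_suml; apply: ideal_sum => p /hs[h1 h2].
by rewrite -mulrA; apply: ideal_mulI => //; exact: IHm.
Qed.

Lemma ideal_expS I J n : I `<=` J -> ideal_exp I n `<=` ideal_exp J n.
Proof.
move=> IJ; elim: n => [//|n IHn] x [s [hs ->]].
by exists s; split=> // p /hs[h1 h2]; split; [exact: IJ | exact: IHn].
Qed.

Definition finitely_generated I := exists (n : nat) (a : 'I_n -> R),
  forall x, I x <-> exists c : 'I_n -> R, x = \sum_i c i * a i.

Definition is_maximal I :=
  ~ I 1 /\ forall K : ideal R, I `<=` K -> ~ K 1 -> K `<=` I.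

(* The A-submodules of J / I are the K / I for K an ideal between I and J, so
   this says that the lengths of chains of submodules of J / I are bounded. *)
Definition finite_length_quotient I J := exists N : nat,
  forall (n : nat) (K : nat -> ideal R),
    (forall i, (i <= n)%N -> I `<=` K i /\ K i `<=` J) ->
    (forall i, (i < n)%N -> K i `<` K i.+1) -> (n <= N)%N.

Definition integral_closure I : set R := [set x | exists (n : nat) (a : nat -> R),
  [/\ (0 < n)%N,
      forall i, (1 <= i <= n)%N -> ideal_exp I i (a i) &
      x ^+ n + \sum_(1 <= i < n.+1) a i * x ^+ (n - i) = 0]].

End IdealTheory.

Definition noetherian (R : comNzRingType) :=
  forall I : ideal R, finitely_generated I.

Definition is_local (R : comNzRingType) (m : ideal R) :=
  is_maximal m /\
  forall m' : ideal R, is_maximal m' -> (m' : set R) = (m : set R).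

Definition is_grading (V : zmodType) (V_ : int -> set V) :=
  [/\ forall n, V_ n 0 /\ (forall x y, V_ n x -> V_ n y -> V_ n (x - y)),
      forall v, exists (s : seq int) (w : int -> V),
        (forall n, V_ n (w n)) /\ v = \sum_(n <- s) w n &
      forall (s : seq int) (w : int -> V), uniq s ->
        (forall n, V_ n (w n)) -> \sum_(n <- s) w n = 0 ->
        forall n, n \in s -> w n = 0].

Record graded_ring := GradedRing {
  gring :> comNzRingType;
  gring_comp : int -> set gring;
  gring_grading : is_grading gring_comp;
  gring_one : gring_comp 0 1;
  gring_mul : forall m n x y,
    gring_comp m x -> gring_comp n y -> gring_comp (m + n) (x * y) }.

Record graded_module (R : graded_ring) := GradedModule {
  gmod :> lmodType R;
  gmod_comp : int -> set gmod;
  gmod_grading : is_grading gmod_comp;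
  gmod_scale : forall m n (r : R) x,
    @gring_comp R m r -> gmod_comp n x -> gmod_comp (m + n) (r *: x) }.

Section LocalCohomology.
Variable R : graded_ring.
Implicit Types M N E : graded_module R.

Definition homogeneous_map M N (f : {linear M -> N}) :=
  forall n, f @` @gmod_comp R M n `<=` @gmod_comp R N n.

(* injective objects of the category of graded modules and homogeneous maps *)
Definition graded_injective E :=
  forall M N (i : {linear M -> N}) (f : {linear M -> E}),
    homogeneous_map i -> injective i -> homogeneous_map f ->
    exists g : {linear N -> E}, homogeneous_map g /\ forall x, g (i x) = f x.

Record injective_resolution M := InjectiveResolution {
  res_obj : nat -> graded_module R;
  res_aug : {linear M -> res_obj 0};
  res_diff : forall i, {linear res_obj i -> res_obj i.+1};
  res_injective : forall i, graded_injective (res_obj i);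
  res_aug_homogeneous : homogeneous_map res_aug;
  res_diff_homogeneous : forall i, homogeneous_map (res_diff i);
  res_aug_inj : injective res_aug;
  res_exact0 : forall x, res_diff 0 x = 0 <-> exists y, res_aug y = x;
  res_exactS : forall i x,
    res_diff i.+1 x = 0 <-> exists y, res_diff i y = x }.

Definition torsion (K : ideal R) (M : lmodType R) : set M :=
  [set x | exists k : nat, forall r, ideal_exp K k r -> r *: x = 0].

Definition cocycle (K : ideal R) M (E : injective_resolution M) (i : nat) :
    set (res_obj E i) :=
  [set x | torsion K x /\ res_diff E i x = 0].

Definition coboundary (K : ideal R) M (E : injective_resolution M) (i : nat) :
    set (res_obj E i) :=
  match i with
  | 0 => [set 0]
  | j.+1 => res_diff E j @` @torsion K (res_obj E j)
  end.

(* H^i_K(M) = cocycle / coboundary is the i-th right derived functor of the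
   K-torsion functor, computed on the resolution E; its degree n component is
   the image of the cocycles of degree n. *)
Definition local_cohomology_vanishes (K : ideal R) M
    (E : injective_resolution M) (i : nat) (n : int) :=
  @cocycle K M E i `&` @gmod_comp R (res_obj E i) n `<=` @coboundary K M E i.

End LocalCohomology.

Section ReesAlgebra.
Variables (A : comNzRingType).

Section ReesRing.
Variable I : ideal A.

Definition rees_pred : {pred {poly A}} :=
  fun p => `[< forall n : nat, ideal_exp I n p`_n >].

Record rees := Rees { rees_val : {poly A}; rees_valP : rees_val \in rees_pred }.

HB.instance Definition _ := [isSub for rees_val].
HB.instance Definition _ := [Choice of rees by <:].

Lemma rees_predP (p : {poly A}) :
  reflect (forall n : nat, ideal_exp I n p`_n) (p \in rees_pred).
Proof. exact: asboolP. Qed.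

Fact rees_subring_closed : subring_closed rees_pred.
Proof.
split=> [|p q /rees_predP hp /rees_predP hq|p q /rees_predP hp /rees_predP hq].
- apply/rees_predP => -[|n]; first by [].
  by rewrite coef1; exact: ideal0.
- apply/rees_predP => n; rewrite coefB -[- _]mulN1r.
  by apply: idealD => //; exact: idealM.
- apply/rees_predP => n; rewrite coefM; apply: ideal_sum => i _.
  by have := ideal_expD (hp i) (hq (n - i)%N); rewrite subnKC // -ltnS.
Qed.

HB.instance Definition _ :=
  GRing.isSubringClosed.Build {poly A} rees_pred rees_subring_closed.
HB.instance Definition _ := [SubChoice_isSubComNzRing of rees by <:].

Lemma rees_val0 : rees_val 0 = 0. Proof. by []. Qed.

Lemma rees_valB p q : rees_val (p - q) = rees_val p - rees_val q.
Proof. by []. Qed.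

Lemma rees_val_sum (T : Type) (s : seq T) (f : T -> rees) :
  rees_val (\sum_(t <- s) f t) = \sum_(t <- s) rees_val (f t).
Proof. exact: (raddf_sum (val : {additive rees -> {poly A}})). Qed.

Definition rees_comp (n : int) : set rees :=
  [set p | forall k : nat, k%:Z != n -> (rees_val p)`_k = 0].

Lemma rees_grading : is_grading rees_comp.
Proof.
split.
- move=> n; split=> [k _|p q hp hq k kn]; first by rewrite rees_val0 coef0.
  by rewrite rees_valB coefB hp // hq // subrr.
- move=> p.
  have mon k : (rees_val p)`_k *: 'X^k \in rees_pred.
    apply/rees_predP => n; rewrite coefZ coefXn.
    case: eqP => [->|_]; last by rewrite mulr0; exact: ideal0.
    by rewrite mulr1; move/rees_predP: (valP p).
  pose w (n : int) : rees := if n is Posz k then Rees (mon k) else 0.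
  exists [seq Posz k | k <- iota 0 (size (rees_val p))], w; split.
    move=> [k|k] j; last by rewrite rees_val0 coef0.
    by rewrite /= coefZ coefXn eqz_nat => /negbTE ->; rewrite mulr0.
  apply: val_inj; rewrite big_map; apply: etrans (esym (rees_val_sum _ _)).
  rewrite /= -[LHS]coefK poly_def.
  by rewrite -[X in iota 0 X]subn0 -/(index_iota 0 _) big_mkord.
- move=> s w us hw sw n ns; apply: val_inj; apply/polyP => k.
  change ((rees_val (w n))`_k = (0 : {poly A})`_k); rewrite coef0.
  have [kn|/hw ->//] := eqVneq k%:Z n.
  move/(congr1 (fun p => (rees_val p)`_k)): sw; rewrite rees_val_sum rees_val0 coef0 coef_sum.
  rewrite (bigD1_seq n) //= big1 ?addr0 // => m mn.
  by apply: hw; rewrite kn eq_sym.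
Qed.

Lemma rees_comp1 : rees_comp 0 1.
Proof. by move=> [|k] // _; rewrite /= coef1. Qed.

Lemma rees_val_mul_comp (B : nzRingType) (p q : {poly B}) (m n : int) :
  (forall k : nat, k%:Z != m -> p`_k = 0) ->
  (forall k : nat, k%:Z != n -> q`_k = 0) ->
  forall k : nat, k%:Z != m + n -> (p * q)`_k = 0.
Proof.
move=> hp hq k kmn; rewrite coefM big1 // => i _.
have [im|/hp ->] := eqVneq (Posz i) m; last by rewrite mul0r.
have [jn|/hq ->] := eqVneq (k - i)%N%:Z n; last by rewrite mulr0.
by case/eqP: kmn; rewrite -im -jn -PoszD subnKC // -ltnS.
Qed.

Lemma rees_compM m n x y :
  rees_comp m x -> rees_comp n y -> rees_comp (m + n) (x * y).
Proof. exact: rees_val_mul_comp. Qed.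

Definition rees_ring : graded_ring :=
  GradedRing rees_grading rees_comp1 rees_compM.

Definition irrelevant_set : set rees_ring := [set p | (rees_val p)`_0 = 0].

Fact irrelevant0 : irrelevant_set 0.
Proof. by rewrite /irrelevant_set /= coef0. Qed.

Fact irrelevantD p q :
  irrelevant_set p -> irrelevant_set q -> irrelevant_set (p + q).
Proof. by rewrite /irrelevant_set /= coefD => -> ->; rewrite addr0. Qed.

Fact irrelevantM a p : irrelevant_set p -> irrelevant_set (a * p).
Proof. by rewrite /irrelevant_set /= coef0M => ->; rewrite mulr0. Qed.

Definition irrelevant_ideal : ideal rees_ring :=
  Ideal irrelevant0 irrelevantD irrelevantM.

End ReesRing.

Section ReesModule.
Variables (I J : ideal A) (IJ : I `<=` J).

Fact rees_incl_subproof (p : rees I) : rees_val p \in rees_pred J.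
Proof.
have /rees_predP hp := rees_valP p.
by apply/rees_predP => n; exact: (@ideal_expS _ _ _ _ IJ _ (hp n)).
Qed.

Definition rees_incl (p : rees I) : rees J := Rees (rees_incl_subproof p).

(* A[Jt] with the A[It]-module structure given by rees_incl *)
Definition rees_over of I `<=` J : Type := rees J.

HB.instance Definition _ := GRing.Zmodule.on (rees_over IJ).

Definition rees_scale (p : rees_ring I) (x : rees_over IJ) : rees_over IJ :=
  rees_incl p * (x : rees J).

Fact rees_scaleA a b x : rees_scale a (rees_scale b x) = rees_scale (a * b) x.
Proof. by apply: val_inj; rewrite /= mulrA. Qed.

Fact rees_scale1 : left_id 1 rees_scale.
Proof. by move=> x; apply: val_inj; rewrite /= mul1r. Qed.

Fact rees_scaleDr : right_distributive rees_scale +%R.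
Proof. by move=> a x y; apply: val_inj; rewrite /= mulrDr. Qed.

Fact rees_scaleDl x : {morph rees_scale^~ x : a b / a + b}.
Proof. by move=> a b; apply: val_inj; rewrite /= mulrDl. Qed.

HB.instance Definition _ :=
  GRing.Zmodule_isLmodule.Build (rees_ring I) (rees_over IJ)
    rees_scaleA rees_scale1 rees_scaleDr rees_scaleDl.

Definition rees_over_comp (n : int) : set (rees_over IJ) := @rees_comp J n.

Fact rees_over_grading : is_grading rees_over_comp.
Proof. exact: rees_grading. Qed.

Fact rees_over_scale m n (r : rees_ring I) x :
  gring_comp m r -> rees_over_comp n x -> rees_over_comp (m + n) (r *: x).
Proof. by move=> hr hx; apply: (@rees_compM J m n (rees_incl r) x). Qed.

Definition rees_module : graded_module (rees_ring I) :=
  GradedModule rees_over_grading rees_over_scale.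

End ReesModule.
End ReesAlgebra.

(* Main.v *)
Require Import Defs.
From HB Require Import structures.
From mathcomp Require Import all_boot all_order all_algebra.
From mathcomp Require Import boolp classical_sets.
From mathcomp Require Import perm zify.

Set Implicit Arguments.
Unset Strict Implicit.
Unset Printing Implicit Defensive.

Import Order.TTheory GRing.Theory Num.Theory.
Local Open Scope classical_set_scope.
Local Open Scope ring_scope.

(** Let x_1, ..., x_r in R_1 generate R_+.  The Koszul complex K(x; M) is
    R_+-torsion, so it only sees the local cohomology of M; as the latter
    vanishes in high degrees, so does the homology of K(x; M), in particular
    M / R_+ M.  For M = A[Jt] this reads J^(n+1) = I J^n for n >> 0, and the
    determinant trick makes J integral over I.

    In terms of a graded injective resolution E: since R is noetherian, the
    torsion of E^i splits off, E^i = T^i + F^i.  By hypothesis T is exact in high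
    degrees, so there F resolves M.  Each F^i is injective and torsion-free, so
    Hom(K(x), F^i) is exact, and dimension shifting along F moves a class of
    top Koszul degree on M down to negative Koszul degree, where it is zero. *)

(** * Hilbert's basis theorem *)

(** The hypothesis supplies a separate degree bound for each cohomological index, with no uniform
    one. The descent shortens the Koszul degree by one each time it advances along the resolution,
    so only indices up to [size xs + 2] occur and a maximum of finitely many bounds suffices.

    Exactness of F in high degrees is usable because the exterior generators have internal degree 1:
    the basis of the Koszul complex sits in degrees >= 0, so a map of degree [n] sends it to degrees
    >= [n], where F is exact.

    The top Koszul cohomology of M is M / (xs) M. The class of [u] is represented by the cochain
    [v |-> ktop v *: u]; if this equals [b \o bd], evaluation at the top basis element writes [u] as
    a value of [b] on a boundary, and boundaries have coefficients in [xs].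

    No quotient module is formed: F^i is the image of a projection [p i] inside [res_obj E i], and
    membership of [y] in F^i reads [p i y = y]. Only graded injectivity is available, so every
    extension is made with homogeneous maps, after a shift of degrees. *)

Section Generators.
Variable R : comNzRingType.
Implicit Types (I K : ideal R) (s : seq R).

(** The ideal generated by [s] is given by its universal property: to prove a statement for all of
    [I], one takes for [K] the ideal of elements satisfying it, and no coefficients appear. *)
Definition generates s I :=
  (forall y, y \in s -> I y) /\
  forall K, (forall y, y \in s -> K y) -> I `<=` K.

Definition span_set s : set R :=
  [set x | exists c : nat -> R, x = \sum_(i < size s) c i * s`_i].

Fact span0 s : span_set s 0.
Proof. by exists (fun=> 0); rewrite big1 // => i _; rewrite mul0r. Qed.

Fact spanD s x y : span_set s x -> span_set s y -> span_set s (x + y).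
Proof.
move=> [c ->] [e ->]; exists (fun i => c i + e i).
by rewrite -big_split; apply: eq_bigr => i _; rewrite mulrDl.
Qed.

Fact spanM s a x : span_set s x -> span_set s (a * x).
Proof.
move=> [c ->]; exists (fun i => a * c i).
by rewrite mulr_sumr; apply: eq_bigr => i _; rewrite mulrA.
Qed.

Definition span s := Ideal (span0 s) (@spanD s) (@spanM s).

Lemma span_gen s y : y \in s -> span s y.
Proof.
move=> ys; exists (fun i => (i == index y s)%:R).
have h : (index y s < size s)%N by rewrite index_mem.
rewrite (bigD1 (Ordinal h)) //= eqxx mul1r nth_index // big1 ?addr0 // => i.
by rewrite -val_eqE /= => /negbTE ->; rewrite mul0r.
Qed.

Lemma finitely_generatedP I : finitely_generated I <-> exists s, generates s I.
Proof.
split=> [[n [a ha]]|[s [sI Is]]].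
  exists (codom a); split=> [y /codomP[i ->]|K hK x /ha[c ->]].
    apply/ha; exists (fun j => (j == i)%:R).
    rewrite (bigD1 i) //= eqxx mul1r big1 ?addr0 // => j /negbTE ->.
    by rewrite mul0r.
  by apply: ideal_sum => i _; apply: idealM; apply/hK/codom_f.
exists (size s), (fun i => s`_i) => x; split=> [Ix|[c ->]].
  by have [c ->] := Is _ (@span_gen s) x Ix; exists (fun i => c i).
by apply: ideal_sum => i _; apply: idealM; apply/sI/mem_nth.
Qed.

Lemma chain_le (F : nat -> ideal R) :
  (forall n, F n `<=` F n.+1) -> forall m n, (m <= n)%N -> F m `<=` F n.
Proof.
move=> hF m n /subnKC <-; elim: (n - m)%N => [|k IHk]; first by rewrite addn0.
by rewrite addnS; apply: subset_trans IHk _; exact: hF.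
Qed.

Lemma noetherian_chain (F : nat -> ideal R) : noetherian R ->
  (forall n, F n `<=` F n.+1) -> exists N, forall n, F n `<=` F N.
Proof.
move=> noeth hF; have le := chain_le hF.
pose U : set R := [set x | exists n, F n x].
have U0 : U 0 by exists 0%N; exact: ideal0.
have UD x y : U x -> U y -> U (x + y).
  move=> [m hm] [n hn]; exists (maxn m n).
  by apply: idealD; [apply: le hm; lia | apply: le hn; lia].
have UM a x : U x -> U (a * x) by move=> [n hn]; exists n; exact: idealM.
have /finitely_generatedP[s [sU Us]] := noeth (Ideal U0 UD UM).
suff [N hN] : exists N, forall y, y \in s -> F N y.
  by exists N => n x hx; apply: (Us (F N)) => //; exists n.
elim: s sU {Us} => [|x s IHs] sU; first by exists 0%N.
have [y|N hN] := IHs; first by move=> ys; apply: sU; rewrite inE ys orbT.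
have [n hn] := sU x (mem_head _ _).
exists (maxn n N) => y; rewrite inE => /orP[/eqP ->|/hN hy].
  by apply: le hn; lia.
by apply: le hy; lia.
Qed.

End Generators.

Lemma noetherian_surj (R S : comNzRingType) (f : {rmorphism R -> S}) :
  noetherian R -> (forall y, exists x, f x = y) -> noetherian S.
Proof.
move=> noeth surj H.
pose P : set R := [set x | H (f x)].
have P0 : P 0 by rewrite /P /= rmorph0; exact: ideal0.
have PD x y : P x -> P y -> P (x + y).
  by rewrite /P /= rmorphD; exact: idealD.
have PM a x : P x -> P (a * x) by rewrite /P /= rmorphM; exact: idealM.
have /finitely_generatedP[s [sP Ps]] := noeth (Ideal P0 PD PM).
apply/finitely_generatedP; exists (map f s); split=> [_ /mapP[y ys ->]|K hK x].
  exact: sP.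
have [y <-] := surj x; move=> Hy.
pose Q : set R := [set x | K (f x)].
have Q0 : Q 0 by rewrite /Q /= rmorph0; exact: ideal0.
have QD u v : Q u -> Q v -> Q (u + v).
  by rewrite /Q /= rmorphD; exact: idealD.
have QM a u : Q u -> Q (a * u) by rewrite /Q /= rmorphM; exact: idealM.
apply: (Ps (Ideal Q0 QD QM)) Hy => z zs.
by apply: hK; exact: map_f.
Qed.

Section HilbertBasis.
Variable R : comNzRingType.
Hypothesis noeth : noetherian R.
Implicit Types (H K : ideal {poly R}) (d : nat).

(** Degree at most [d], rather than exactly [d], keeps 0 and sums with cancelling leading terms in
    the set, which is thus an ideal. *)
Definition lead_set H d : set R :=
  [set c | exists p, [/\ H p, (size p <= d.+1)%N & p`_d = c]].

Fact lead0 H d : lead_set H d 0.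
Proof. by exists 0; rewrite size_poly0 coef0; split=> //; exact: ideal0. Qed.

Fact leadD H d x y : lead_set H d x -> lead_set H d y -> lead_set H d (x + y).
Proof.
move=> [p [Hp sp <-]] [q [Hq sq <-]]; exists (p + q); rewrite coefD.
split=> //; first exact: idealD.
by apply: leq_trans (size_polyD _ _) _; rewrite geq_max sp.
Qed.

Fact leadM H d a x : lead_set H d x -> lead_set H d (a * x).
Proof.
move=> [p [Hp sp <-]]; exists (a%:P * p); rewrite coefCM; split=> //.
  exact: idealM.
by rewrite mul_polyC; apply: leq_trans (size_scale_leq _ _) _.
Qed.

Definition lead H d := Ideal (lead0 H d) (@leadD H d) (@leadM H d).

Lemma lead_leS H d : lead H d `<=` lead H d.+1.
Proof.
move=> x [p [Hp sp <-]]; exists ('X * p); rewrite coefXM; split=> //.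
  exact: idealM.
apply: leq_trans (size_polyMleq _ _) _.
by rewrite size_polyX.
Qed.

Lemma lead_lift H d : exists s : seq {poly R},
  (forall p, p \in s -> H p) /\
  forall K, (forall p, p \in s -> K p) -> K `<=` H -> lead H d `<=` lead K d.
Proof.
have /finitely_generatedP[cs [csH Hcs]] := noeth (lead H d).
have [s [sH hs]] : exists s : seq {poly R}, (forall p, p \in s -> H p) /\
    forall c, c \in cs -> exists p,
      [/\ p \in s, (size p <= d.+1)%N & p`_d = c].
  elim: cs csH {Hcs} => [|c cs IHcs] csH; first by exists [::].
  have [y|s [sH hs]] := IHcs; first by move=> h; apply: csH; rewrite inE h orbT.
  have [p [Hp sp pc]] := csH c (mem_head _ _).
  exists (p :: s); split=> [q|e]; rewrite inE => /orP[/eqP ->//|].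
  - exact: sH.
  - by exists p; rewrite mem_head.
  - by move=> /hs[q [qs sq qe]]; exists q; rewrite inE qs orbT.
exists s; split=> // K sK _.
by apply: Hcs => c /hs[p [/sK Kp sp pc]]; exists p.
Qed.

Theorem Hilbert_basis : noetherian {poly R}.
Proof.
move=> H; apply/finitely_generatedP.
have [D hD] := noetherian_chain noeth (@lead_leS H).
have [s [sH hs]] : exists s : seq {poly R}, (forall p, p \in s -> H p) /\
    forall K, (forall p, p \in s -> K p) -> K `<=` H ->
    forall d, (d <= D)%N -> lead H d `<=` lead K d.
  elim: D {hD} => [|D [s [sH hs]]].
    have [s [sH hs]] := lead_lift H 0; exists s; split=> // K sK KH d.
    by rewrite leqn0 => /eqP ->; exact: hs.
  have [t [tH ht]] := lead_lift H D.+1; exists (s ++ t).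
  split=> [p|K sK KH d]; first by rewrite mem_cat => /orP[/sH|/tH].
  rewrite leq_eqVlt => /orP[/eqP ->|dD].
    by apply: ht => // p pt; apply: sK; rewrite mem_cat pt orbT.
  by apply: hs => // p ps; apply: sK; rewrite mem_cat ps.
exists s; split=> // K0 sK0.
(* Intersecting with [H] ensures that the polynomial [q] subtracted from [p] below lies in [H] too,
   so that the induction on the size applies to [p - q]. *)
pose K' : set {poly R} := [set x | K0 x /\ H x].
have K'0 : K' 0 by split; exact: ideal0.
have K'D x y : K' x -> K' y -> K' (x + y).
  by move=> [? ?] [? ?]; split; exact: idealD.
have K'M a x : K' x -> K' (a * x) by move=> [? ?]; split; exact: idealM.
pose K := Ideal K'0 K'D K'M.
have hK d : lead H d `<=` lead K d.
  have KH : K `<=` H by move=> x [].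
  have sK p : p \in s -> K p by move=> ps; split; [exact: sK0 | exact: sH].
  have [dD|/ltnW Dd] := leqP d D; first exact: hs.
  apply: subset_trans (hD d) _; apply: subset_trans (hs K sK KH D _) _ => //.
  exact: chain_le (@lead_leS K) _ _ Dd.
suff h n (p : {poly R}) : (size p <= n)%N -> H p -> K0 p.
  by move=> p; exact: h (leqnn _).
elim: n p => [|n IHn] p sp Hp.
  by rewrite leqn0 size_poly_eq0 in sp; rewrite (eqP sp); exact: ideal0.
have [|q [[K0q Hq] sq pq]] := hK n p`_n; first by exists p.
rewrite -(subrK q p); apply: idealD => //; apply: IHn; last first.
  by rewrite -mulN1r; apply: idealD => //; exact: idealM.
apply/leq_sizeP => j; rewrite leq_eqVlt => /orP[/eqP <-|nj].
  by rewrite coefB pq subrr.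
by rewrite coefB !nth_default ?subrr //; apply: leq_trans nj.
Qed.

End HilbertBasis.

(** Generators are adjoined one at a time: [A] is replaced by the polynomial ring over [A], whose
    variable is sent to [x]. The induction principle in the hypothesis expresses that the image of
    [f] and [xs] generate the ring [S]. *)
Lemma noetherian_algebra (A S : comNzRingType) (f : {rmorphism A -> S})
    (xs : seq S) : noetherian A ->
  (forall P : S -> Prop, (forall a, P (f a)) -> (forall x, x \in xs -> P x) ->
     (forall x y, P x -> P y -> P (x + y)) ->
     (forall x y, P x -> P y -> P (x * y)) -> forall x, P x) ->
  noetherian S.
Proof.
elim: xs A f => [|x xs IHxs] A f noeth gen.
  apply: (noetherian_surj noeth (f := f)) => y.
  apply: (gen (fun y => exists x, f x = y)) => //=; first by move=> a; exists a.
    by move=> _ _ [u <-] [v <-]; exists (u + v); rewrite rmorphD.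
  by move=> _ _ [u <-] [v <-]; exists (u * v); rewrite rmorphM.
have cfx : commr_rmorph f x by move=> a; exact: mulrC.
apply: (IHxs _ (horner_morph cfx) (Hilbert_basis noeth)) => P Pf Pxs PD PM.
apply: gen => // [a|y].
  by rewrite -(horner_morphC cfx); exact: Pf.
rewrite inE => /orP[/eqP ->|/Pxs//].
by rewrite -(horner_morphX cfx); exact: Pf.
Qed.

(** * Graded modules *)

Section Grading.
Variables (V : zmodType) (V_ : int -> set V).
Hypothesis gr : is_grading V_.

Lemma homog0 n : V_ n 0.
Proof. by case: gr => h _ _; case: (h n). Qed.

Lemma homogB n x y : V_ n x -> V_ n y -> V_ n (x - y).
Proof. by case: gr => h _ _; case: (h n) => _; exact. Qed.

Lemma homogN n x : V_ n x -> V_ n (- x).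
Proof. by move=> h; rewrite -sub0r; exact: homogB (homog0 n) h. Qed.

Lemma homogD n x y : V_ n x -> V_ n y -> V_ n (x + y).
Proof.
by move=> hx hy; rewrite -[y]opprK; apply: homogB => //; exact: homogN.
Qed.

Definition decomposition (v : V) (w : int -> V) :=
  (forall n, V_ n (w n)) /\
  exists s : seq int, [/\ uniq s, forall n, n \notin s -> w n = 0 &
                          v = \sum_(n <- s) w n].

Lemma sum_support (w : int -> V) (s t : seq int) :
  uniq s -> uniq t -> (forall n, n \notin s -> w n = 0) ->
  {subset s <= t} -> \sum_(n <- t) w n = \sum_(n <- s) w n.
Proof.
move=> us ut ws st; rewrite (bigID (mem s)) /= [X in _ + X]big1 ?addr0.
  rewrite -big_filter; apply: perm_big; apply: uniq_perm => //.
    exact: filter_uniq.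
  move=> n; rewrite mem_filter /=.
  by case ns: (n \in s) => //=; rewrite st.
by move=> n /ws.
Qed.

Lemma decomposition_ex v : exists w, decomposition v w.
Proof.
case: gr => _ /(_ v)[s [w [hw ->]]] _.
(* [is_grading] allows a degree to be repeated in [s]; the repetitions are absorbed as
   multiplicities. *)
exists (fun n => w n *+ count_mem n s); split=> [n|].
  elim: (count_mem n s) => [|k IHk]; first exact: homog0.
  by rewrite mulrS; exact: homogD.
exists (undup s); split; first exact: undup_uniq.
  by move=> n; rewrite mem_undup => /count_memPn ->.
by rewrite -big_undup_iterop_count.
Qed.

Lemma decompositionB v w v' w' : decomposition v w -> decomposition v' w' ->
  decomposition (v - v') (fun n => w n - w' n).
Proof.
move=> [hw [s [us ws ->]]] [hw' [s' [us' ws' ->]]].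
split=> [n|]; first exact: homogB.
exists (undup (s ++ s')); split; first exact: undup_uniq.
  move=> n; rewrite mem_undup mem_cat negb_or => /andP[/ws -> /ws' ->].
  by rewrite subrr.
rewrite big_split sumrN /=.
rewrite (sum_support us (undup_uniq _) ws) ?(sum_support us' (undup_uniq _) ws')//.
  by move=> n ns; rewrite mem_undup mem_cat ns orbT.
by move=> n ns; rewrite mem_undup mem_cat ns.
Qed.

Lemma decomposition_uniq v w w' :
  decomposition v w -> decomposition v w' -> w = w'.
Proof.
move=> dw dw'; have := decompositionB dw dw'; rewrite subrr.
move=> [hw [s [us ws /esym s0]]]; apply/funext => n; apply/eqP.
rewrite -subr_eq0; apply/eqP; case: gr => _ _ indep.
by have [ns|/ws//] := boolP (n \in s); exact: (indep s _ us hw).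
Qed.

Definition gproj (n : int) (v : V) : V := sval (cid (decomposition_ex v)) n.

Lemma gprojP v : decomposition v (gproj ^~ v).
Proof. by rewrite /gproj; case: cid. Qed.

Lemma decomposition_gproj v w n : decomposition v w -> gproj n v = w n.
Proof. by move=> /(decomposition_uniq (gprojP v)) <-. Qed.

Lemma gproj_in n v : V_ n (gproj n v).
Proof. by case: (gprojP v). Qed.

Lemma gproj_homog n v k : V_ n v -> gproj k v = if k == n then v else 0.
Proof.
move=> hv; have dv : decomposition v (fun k => if k == n then v else 0).
  split=> [m|]; first by case: eqP => [->//|_]; exact: homog0.
  exists [:: n]; split=> // [m|]; first by rewrite inE => /negbTE ->.
  by rewrite big_seq1 eqxx.
exact: (decomposition_gproj _ dv).
Qed.

Lemma gproj_id n v : V_ n v -> gproj n v = v.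
Proof. by move/gproj_homog ->; rewrite eqxx. Qed.

Lemma gprojB n u v : gproj n (u - v) = gproj n u - gproj n v.
Proof.
exact: (decomposition_gproj _ (decompositionB (gprojP u) (gprojP v))).
Qed.

Lemma gproj0 n : gproj n 0 = 0.
Proof. by rewrite -[X in gproj _ X](subrr (0 : V)) gprojB subrr. Qed.

Lemma gprojD n u v : gproj n (u + v) = gproj n u + gproj n v.
Proof.
have -> : u + v = u - (0 - v) by rewrite sub0r opprK.
by rewrite !gprojB gproj0 sub0r opprK.
Qed.

Lemma gproj_ind (P : V -> Prop) (v : V) : P 0 ->
  (forall x y, P x -> P y -> P (x + y)) -> (forall n, P (gproj n v)) -> P v.
Proof.
move=> P0 PD Pv; have [_ [s [_ _ ->]]] := gprojP v.
by elim/big_ind: _.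
Qed.

End Grading.

(** By uniqueness of decompositions, projections commute with every additive map of degree [d]. This
    serves three times: for homogeneous maps, for scaling by a homogeneous [r], and for
    [r |-> r *: v] with [v] homogeneous. *)
Lemma gproj_shift (V W : zmodType) (V_ : int -> set V) (W_ : int -> set W)
    (grV : is_grading V_) (grW : is_grading W_) (d : int) (f : {additive V -> W}) :
  (forall n v, V_ n v -> W_ (n + d) (f v)) ->
  forall n v, gproj grW (n + d) (f v) = f (gproj grV n v).
Proof.
move=> hf n v.
have dfv : decomposition W_ (f v) (fun k => f (gproj grV (k - d) v)).
  split=> [k|]; first by have := hf _ _ (gproj_in grV (k - d) v); rewrite subrK.
  have [_ [s [us ws vE]]] := gprojP grV v.
  exists [seq k + d | k <- s]; split.
  - by rewrite map_inj_uniq //; exact: addIr.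
  - move=> k ks; rewrite /= ws ?raddf0 //; apply: contra ks => ks.
    by apply/mapP; exists (k - d) => //; rewrite subrK.
  - by rewrite {1}vE raddf_sum big_map; apply: eq_bigr => k _; rewrite addrK.
by rewrite (decomposition_gproj _ _ dfv) addrK.
Qed.

Section LinOf.
Variables (R : pzRingType) (U V : lmodType R) (f : U -> V).
Definition lin_of of linear f := f.
Hypothesis lf : linear f.
HB.instance Definition _ := GRing.isLinear.Build R U V _ (lin_of lf) lf.
End LinOf.

Section GradedModules.
Variable R : graded_ring.
Implicit Types (M N E : graded_module R).

Definition gcomp M (n : int) (v : M) : M := gproj (gmod_grading M) n v.
Definition rcomp (n : int) (r : R) : R := gproj (gring_grading R) n r.

Lemma gcomp_in M n (v : M) : gmod_comp n (gcomp n v).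
Proof. exact: gproj_in. Qed.

Lemma gcomp_id M n (v : M) : gmod_comp n v -> gcomp n v = v.
Proof. exact: gproj_id. Qed.

Lemma gcompD M n (u v : M) : gcomp n (u + v) = gcomp n u + gcomp n v.
Proof. exact: gprojD. Qed.

Lemma homogeneousP M N (f : {linear M -> N}) :
  homogeneous_map f <-> forall n x, gmod_comp n x -> gmod_comp n (f x).
Proof.
split=> [h n x hx|h n _ [x hx <-]]; last exact: h.
by apply: h; exists x.
Qed.

Lemma gcomp_hom M N (f : {linear M -> N}) n v :
  homogeneous_map f -> gcomp n (f v) = f (gcomp n v).
Proof.
move=> /homogeneousP hf; rewrite -[n in LHS]addr0.
by apply: gproj_shift => k x; rewrite addr0; exact: hf.
Qed.

Lemma gcomp_scale M d n (r : R) (v : M) :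
  gring_comp d r -> gcomp (n + d) (r *: v) = r *: gcomp n v.
Proof.
move=> hr; apply: (gproj_shift (gmod_grading M) (gmod_grading M) (f := *:%R r)).
by move=> k x hx; rewrite addrC; exact: gmod_scale.
Qed.

Lemma gcomp_rcomp M d n (r : R) (v : M) :
  gmod_comp d v -> gcomp (n + d) (r *: v) = rcomp n r *: v.
Proof.
move=> hv.
have lin : linear (fun r : R^o => r *: v : M).
  by move=> a x y; rewrite scalerDl scalerA.
have h k x : gring_comp k x -> gmod_comp (k + d) (lin_of lin x).
  by move=> hx; exact: gmod_scale.
exact: (@gproj_shift R^o M _ _ (gring_grading R) (gmod_grading M) d (lin_of lin) h).
Qed.

(** * Shifts, direct sums and submodules of graded modules *)

Section Shift.
Variables (M : graded_module R) (s : int).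

Definition shift_comp (n : int) : set M := gmod_comp (n - s).

Fact shift_grading : is_grading shift_comp.
Proof.
split=> [n|v|t w ut hw sw].
- by split=> [|x y]; [exact: (homog0 (gmod_grading M))
                    | exact: (homogB (gmod_grading M))].
- have [hw [t [_ _ vE]]] := gprojP (gmod_grading M) v.
  exists [seq n + s | n <- t], (fun n => gcomp (n - s) v).
  split=> [n|]; first exact: gcomp_in.
  by rewrite {1}vE big_map; apply: eq_bigr => n _; rewrite addrK.
- move=> n nt; have [_ _ indep] := gmod_grading M.
  have := indep [seq n - s | n <- t] (fun n => w (n + s)).
  rewrite map_inj_uniq ?ut; last exact: addIr.
  move=> /(_ isT) h; have /h : forall n, gmod_comp n (w (n + s)).
    by move=> k; have := hw (k + s); rewrite /shift_comp addrK.
  rewrite big_map => h'.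
  rewrite -[n](subrK s); apply: h'; last exact: map_f.
  by rewrite -[RHS]sw; apply: eq_bigr => k _; rewrite subrK.
Qed.

Fact shift_scale m n (r : R) x :
  gring_comp m r -> shift_comp n x -> shift_comp (m + n) (r *: x).
Proof. by move=> hr hx; rewrite /shift_comp -addrA; exact: gmod_scale. Qed.

(* The module usually denoted M(-s). *)
Definition gshift := GradedModule shift_grading shift_scale.

End Shift.

Section DirectSum.
Variables M N : graded_module R.

Definition gsum_comp (n : int) : set (M * N)%type :=
  [set x | gmod_comp n x.1 /\ gmod_comp n x.2].

Fact gsum_grading : is_grading gsum_comp.
Proof.
have sum12 (s : seq int) (w : int -> (M * N)%type) :
    \sum_(n <- s) w n = (\sum_(n <- s) (w n).1, \sum_(n <- s) (w n).2).
  by elim/big_rec3: _ => // n a b x _ ->; case: (w n).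
split=> [n|v|s w us hw].
- split=> [|x y [? ?] [? ?]].
    by split; [exact: (homog0 (gmod_grading M)) | exact: (homog0 (gmod_grading N))].
  by split; [exact: (homogB (gmod_grading M)) | exact: (homogB (gmod_grading N))].
- have [h1 [s1 [us1 ws1 e1]]] := gprojP (gmod_grading M) v.1.
  have [h2 [s2 [us2 ws2 e2]]] := gprojP (gmod_grading N) v.2.
  exists (undup (s1 ++ s2)), (fun n => (gcomp n v.1, gcomp n v.2)).
  split=> [n|]; first by split; exact: gcomp_in.
  rewrite sum12 /= (sum_support us1 (undup_uniq _) ws1); last first.
    by move=> n; rewrite mem_undup mem_cat => ->.
  rewrite (sum_support us2 (undup_uniq _) ws2); last first.
    by move=> n; rewrite mem_undup mem_cat => ->; rewrite orbT.
  by rewrite -e1 -e2; case: v {h1 h2 ws1 ws2 e1 e2}.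
- rewrite sum12 => -[z1 z2] n ns.
  have [_ _ i1] := gmod_grading M; have [_ _ i2] := gmod_grading N.
  have e1 : (w n).1 = 0.
    by apply: (i1 s (fun n => (w n).1)) => // k; case: (hw k).
  have e2 : (w n).2 = 0.
    by apply: (i2 s (fun n => (w n).2)) => // k; case: (hw k).
  by case: (w n) e1 e2 => a b /= -> ->.
Qed.

Fact gsum_scale m n (r : R) x :
  gring_comp m r -> gsum_comp n x -> gsum_comp (m + n) (r *: x).
Proof. by move=> hr [h1 h2]; split; exact: gmod_scale. Qed.

Definition gsum := GradedModule gsum_grading gsum_scale.

End DirectSum.

Section Submodule.
Variable (M : graded_module R).

Record graded_submodule := GradedSubmodule {
  gsub_mem :> M -> Prop;
  gsub0 : gsub_mem 0;
  gsubD : forall x y, gsub_mem x -> gsub_mem y -> gsub_mem (x + y);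
  gsubZ : forall a x, gsub_mem x -> gsub_mem (a *: x);
  gsub_proj : forall n x, gsub_mem x -> gsub_mem (gcomp n x) }.

Variable P : graded_submodule.

Definition gsub_pred : {pred M} := fun x => `[< P x >].

Record gsub := GSub { gsub_val : M; gsub_valP : gsub_val \in gsub_pred }.

HB.instance Definition _ := [isSub for gsub_val].
HB.instance Definition _ := [Choice of gsub by <:].

Fact gsub_submod : submod_closed gsub_pred.
Proof.
split; first by apply/asboolP; exact: gsub0.
move=> a x y /asboolP hx /asboolP hy; apply/asboolP.
by apply: gsubD => //; exact: gsubZ.
Qed.

HB.instance Definition _ :=
  GRing.isSubmodClosed.Build R M gsub_pred gsub_submod.
HB.instance Definition _ := [SubChoice_isSubLmodule of gsub by <:].

Definition gsub_comp (n : int) : set gsub := [set x | gmod_comp n (gsub_val x)].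

Lemma gsub_val_sum (s : seq int) (w : int -> gsub) :
  gsub_val (\sum_(n <- s) w n) = \sum_(n <- s) gsub_val (w n).
Proof. exact: (raddf_sum (val : {additive gsub -> M})). Qed.

Fact gsub_grading : is_grading gsub_comp.
Proof.
split=> [n|v|s w us hw sw n ns].
- by split=> [|x y]; [exact: (homog0 (gmod_grading M))
                    | exact: (homogB (gmod_grading M))].
- have [hw [s [us ws e]]] := gprojP (gmod_grading M) (gsub_val v).
  have Pv n : gcomp n (gsub_val v) \in gsub_pred.
    by apply/asboolP/gsub_proj/asboolP; exact: gsub_valP.
  exists s, (fun n => GSub (Pv n)); split=> [n|]; first exact: gcomp_in.
  by apply: val_inj; apply: etrans e _; rewrite -[RHS]/(gsub_val _) gsub_val_sum.
- have [_ _ indep] := gmod_grading M; apply: val_inj.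
  apply: (indep s (fun n => gsub_val (w n))) => //.
  by rewrite -gsub_val_sum sw.
Qed.

Fact gsub_scale m n (r : R) x :
  gring_comp m r -> gsub_comp n x -> gsub_comp (m + n) (r *: x).
Proof. by move=> hr hx; exact: gmod_scale. Qed.

Definition gsubmod := GradedModule gsub_grading gsub_scale.

Lemma gsub_mem_val (v : gsubmod) : P (gsub_val v).
Proof. exact: (asboolW (gsub_valP v)). Qed.

Lemma gsub_val_linear : linear (gsub_val : gsubmod -> M).
Proof. by []. Qed.

Definition gsub_incl : {linear gsubmod -> M} := lin_of gsub_val_linear.

Lemma gsub_incl_inj : injective gsub_incl.
Proof. exact: val_inj. Qed.

End Submodule.

End GradedModules.

(** * Splitting off the torsion of a graded injective module *)

Section TorsionRetraction.
Variables (R : graded_ring) (xs : seq R) (K : ideal R).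
Hypothesis noeth : noetherian R.
Hypothesis deg1 : forall x, x \in xs -> gring_comp 1 x.
Hypothesis xsK : generates xs K.

Lemma exp_mem x k : x \in xs -> ideal_exp K k (x ^+ k).
Proof.
move=> xK; elim: k => [//|k IHk]; rewrite exprS; apply: ideal_mulI => //.
by case: xsK => h _; exact: h.
Qed.

Lemma torsion_le (M : lmodType R) (y : M) k n : (k <= n)%N ->
  (forall r, ideal_exp K k r -> r *: y = 0) ->
  forall r, ideal_exp K n r -> r *: y = 0.
Proof.
move=> /subnKC <- h; elim: (n - k)%N => [|m IHm]; first by rewrite addn0.
rewrite addnS => r [s [hs ->]]; rewrite scaler_suml big_seq big1 // => p /hs[_ h2].
by rewrite -scalerA IHm // scaler0.
Qed.

Lemma torsion_step (M : lmodType R) (y : M) :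
  (forall x, x \in xs -> torsion K (x *: y)) -> torsion K y.
Proof.
move=> h; have [k hk] : exists k, forall x, x \in xs ->
    forall r, ideal_exp K k r -> r *: (x *: y) = 0.
  elim: (xs) h => [|x s IHs] h; first by exists 0%N.
  have [z zs|k hk] := IHs; first by apply: h; rewrite inE zs orbT.
  have [l hl] := h x (mem_head _ _); exists (maxn k l) => z.
  rewrite inE => /orP[/eqP ->|zs]; first by apply: torsion_le hl; lia.
  by apply: torsion_le (hk _ zs); lia.
exists k.+1 => r [s [hs ->]].
rewrite scaler_suml big_seq big1 // => p /hs[h1 h2].
(* This is an ideal containing [xs], hence it contains [K] and in particular [p.1]. *)
pose A : set R := [set a | (a * p.2) *: y = 0].
have A0 : A 0 by rewrite /A /= mul0r scale0r.
have AD a b : A a -> A b -> A (a + b).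
  by rewrite /A /= mulrDl scalerDl => -> ->; rewrite addr0.
have AM a b : A b -> A (a * b).
  by rewrite /A /= -mulrA -[(a * _) *: y]scalerA => ->; rewrite scaler0.
case: xsK => _ /(_ (Ideal A0 AD AM)); apply => // x xK.
by rewrite /= /A /= mulrC -scalerA hk.
Qed.

(** With finitely many generators, nilpotent action of each one is enough. In this form torsion is
    easily seen to be stable under sums and homogeneous components. *)
Lemma torsionP (M : lmodType R) (y : M) :
  torsion K y <-> forall x, x \in xs -> exists l, x ^+ l *: y = 0.
Proof.
split=> [[k hk] x xK|h]; first by exists k; apply/hk/exp_mem.
have /choice[l hl] x : exists l, x \in xs -> x ^+ l *: y = 0.
  by have [/h[l hl]|_] := boolP (x \in xs); [exists l | exists 0%N].
(* Induction on the total exponent: replacing [y] by [x *: y] lowers the exponent of [x] by one, and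
   [torsion_step] returns to [y]. *)
move: {2}(\sum_(x <- xs) l x)%N (leqnn (\sum_(x <- xs) l x)) => N.
elim: N y l hl {h} => [|N IHN] y l hl hN; apply: torsion_step => x xK.
  have lx : l x = 0%N.
    apply/eqP; rewrite -leqn0; apply: leq_trans hN.
    by rewrite (big_rem x) //= leq_addr.
  move: (hl x xK); rewrite lx scale1r => ->.
  by exists 0%N => r _; rewrite !scaler0.
case lx: (l x) => [|k].
  by move: (hl x xK); rewrite lx scale1r => ->; exists 0%N => r _; rewrite !scaler0.
apply: (IHN _ (fun z => if z == x then k else l z)) => [z zK|].
  case: eqP => [->|_]; first by rewrite scalerA -exprSr -lx; exact: hl.
  by rewrite scalerA mulrC -scalerA hl ?scaler0.
have sumE f : (\sum_(z <- xs) f z = f x + \sum_(z <- rem x xs) f z)%N.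
  exact: big_rem.
rewrite sumE eqxx; move: hN; rewrite sumE lx addSn ltnS; apply: leq_trans.
by rewrite leq_add2l; apply: leq_sum => z _; case: eqP => // ->; rewrite lx.
Qed.

Lemma expr_comp (x : R) l : gring_comp 1 x -> gring_comp (Posz l) (x ^+ l).
Proof.
move=> hx; elim: l => [|l IHl]; first exact: gring_one.
by rewrite exprS -add1n PoszD; exact: gring_mul.
Qed.

Section TorsionSubmodule.
Variable E : graded_module R.

Fact torsion0 : @torsion R K E 0.
Proof. by exists 0%N => r _; rewrite scaler0. Qed.

Fact torsionD (y z : E) : torsion K y -> torsion K z -> torsion K (y + z).
Proof.
move=> /torsionP hy /torsionP hz; apply/torsionP => x xK.
have [k hk] := hy x xK; have [l hl] := hz x xK; exists (k + l)%N.
by rewrite scalerDr {1}addnC !exprD -!scalerA hk hl !scaler0 addr0.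
Qed.

Fact torsionZ a (y : E) : torsion K y -> torsion K (a *: y).
Proof.
by move=> [k hk]; exists k => r hr; rewrite scalerA mulrC -scalerA hk ?scaler0.
Qed.

Fact torsion_gcomp n (y : E) : torsion K y -> torsion K (gcomp n y).
Proof.
move=> /torsionP hy; apply/torsionP => x xK; have [l hl] := hy x xK; exists l.
rewrite -(@gcomp_scale _ _ (Posz l)); last by apply/expr_comp/deg1.
by rewrite hl; exact: gproj0.
Qed.

Definition torsion_sub := GradedSubmodule torsion0 torsionD torsionZ torsion_gcomp.

End TorsionSubmodule.

Lemma torsion_linear (E F : graded_module R) (f : {linear E -> F}) y :
  torsion K y -> torsion K (f y).
Proof. by move=> [k hk]; exists k => r /hk h; rewrite -linearZ_LR h linear0. Qed.

(* A complement of the torsion is a maximal graded submodule [C] meeting it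
   trivially: by noetherianity [(C : x ^ l y)] stabilizes, which forces
   [x ^ l y] into [C] for large [l], so that [E / C] is torsion. *)
Lemma torsion_retraction (E : graded_module R) : graded_injective E ->
  exists r : {linear E -> E}, [/\ homogeneous_map r,
    forall y, torsion K y -> r y = y & forall y, torsion K (r y)].
Proof.
move=> injE; pose T := torsion_sub E.
(* Membership of 0 is not demanded, because the empty chain has empty union and must satisfy [P] as
   well. Maximality against [[set 0]] recovers it afterwards. *)
pose P (C : set E) := [/\ forall x y, C x -> C y -> C (x + y),
  forall a x, C x -> C (a *: x), forall n x, C x -> C (gcomp n x) &
  forall x, C x -> T x -> x = 0].
have [C [[CD CZ Cg CT] Cmax]] : exists C, P C /\ forall B, C `<` B -> ~ P B.
  apply: Zorn_bigcup => F FP Ftot; split.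
  - move=> x y [A FA Ax] [B FB By]; have [AB|BA] := Ftot A B FA FB.
      by exists B => //; have [h _ _ _] := FP B FB; apply: h => //; exact: AB.
    by exists A => //; have [h _ _ _] := FP A FA; apply: h => //; exact: BA.
  - by move=> a x [A FA Ax]; exists A => //; have [_ h _ _] := FP A FA; exact: h.
  - by move=> n x [A FA Ax]; exists A => //; have [_ _ h _] := FP A FA; exact: h.
  - by move=> x [A FA Ax]; have [_ _ _ h] := FP A FA; exact: h.
have C0 : C 0.
  apply: contrapT => nC0; apply: (Cmax [set 0]).
    split=> [x Cx|]; first by case: nC0; rewrite -(scale0r x); exact: CZ.
    by move=> /(_ 0); apply: contra_not nC0; exact.
  split=> [x y -> ->|a x ->|n x ->|x //]; rewrite ?addr0 ?scaler0 //.
  exact: gproj0.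
pose S := GradedSubmodule C0 CD CZ Cg.
(* The sum map from T + C to E is injective since T and C meet trivially. Extending the projection
   onto T along it yields [r], the identity on T and zero on C. *)
pose X := gsum (gsubmod T) (gsubmod S).
have lu : linear (fun v : X => gsub_incl T v.1 + gsub_incl S v.2).
  by move=> a u v; rewrite !linearP scalerDr addrACA.
have lf : linear (fun v : X => gsub_incl T v.1) by move=> a u v; rewrite linearP.
have hu : homogeneous_map (lin_of lu : {linear X -> E}).
  apply/homogeneousP => n v [h1 h2]; exact: (homogD (gmod_grading E) h1 h2).
have hf : homogeneous_map (lin_of lf : {linear X -> E}).
  by apply/homogeneousP => n v [].
have injlu : injective (lin_of lu : {linear X -> E}).
  apply: raddf_inj => -[a b] e0.
  have /eqP e : gsub_incl T a + gsub_incl S b = 0 := e0.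
  have Ta : T (gsub_incl T a) by exact: gsub_mem_val.
  have Cb : C (gsub_incl S b) by exact: (@gsub_mem_val _ _ S).
  have ea : gsub_incl T a = - gsub_incl S b by apply/eqP; rewrite -addr_eq0.
  have a0 : gsub_incl T a = 0.
    by apply: CT => //; rewrite ea -scaleN1r; exact: (CZ).
  have b0 : gsub_incl S b = 0 by apply/eqP; rewrite -oppr_eq0 -ea a0.
  congr (_, _); apply: gsub_incl_inj; first by rewrite a0 linear0.
  by rewrite b0 linear0.
have [r [hr rP]] := injE _ _ _ _ hu injlu hf.
have rT y : T y -> r y = y.
  move=> Ty; have Ty' : y \in gsub_pred T by apply/asboolP.
  have : r (y + gsub_incl S 0) = y := rP (GSub Ty', 0).
  by rewrite linear0 addr0.
have rC y : C y -> r y = 0.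
  move=> Cy; have Cy' : y \in gsub_pred S by apply/asboolP.
  have : r (gsub_incl T 0 + y) = gsub_incl T 0 := rP (0, GSub Cy').
  by rewrite linear0 add0r.
exists r; split=> // y.
(* Homogeneity of [z] makes C + R w, with [w] a power of [x] times [z], a graded submodule that can
   be compared with the maximal C. *)
have hom d z : gmod_comp d z -> torsion K (r z).
  move=> hz; apply/torsionP => x xK.
  pose F l : set R := [set a | C (a *: (x ^+ l *: z))].
  have F0 l : F l 0 by rewrite /F /= scale0r.
  have FD l a b : F l a -> F l b -> F l (a + b).
    by rewrite /F /= scalerDl; exact: (CD).
  have FM l a b : F l b -> F l (a * b) by rewrite /F /= -scalerA; exact: (CZ).
  pose FI l := Ideal (F0 l) (@FD l) (@FM l).
  have [|N hN] := noetherian_chain (F := FI) noeth.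
    move=> l a; rewrite /= /F /= exprS -scalerA [a *: (x *: _)]scalerA mulrC.
    by rewrite -scalerA; exact: (CZ).
  exists N; rewrite -linearZ_LR; apply: rC; apply: contrapT => nCz.
  set w := x ^+ N *: z in nCz.
  have hw : gmod_comp (Posz N + d) w.
    by apply/gmod_scale => //; apply/expr_comp/deg1.
  apply: (Cmax [set v | exists c a, C c /\ v = c + a *: w]).
    split=> [c Cc|]; first by exists c, 0; rewrite scale0r addr0.
    by move=> h; apply: nCz; apply: h; exists 0, 1; rewrite scale1r add0r.
  split.
  - move=> _ _ [c [a [hc ->]]] [e [b [he ->]]]; exists (c + e), (a + b).
    by rewrite scalerDl addrACA; split=> //; exact: (CD).
  - move=> b _ [c [a [hc ->]]]; exists (b *: c), (b * a).
    by rewrite scalerDr scalerA; split=> //; exact: (CZ).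
  - move=> n _ [c [a [hc ->]]]; exists (gcomp n c), (rcomp (n - (Posz N + d)) a).
    split; first exact: (Cg).
    by rewrite gcompD -{2}[n](subrK (Posz N + d)) (gcomp_rcomp _ _ hw).
  (* If [x ^+ l] kills [c + a *: w], then [a] lies in [F (N + l)], hence in [F N]; so [a *: w] is
     already in C, and the torsion element [c + a *: w] of C vanishes. *)
  - move=> _ [c [a [hc ->]]] /[dup] Tv /torsionP/(_ x xK)[l hl].
    apply: CT => //; apply: (CD) => //.
    suff : F (N + l)%N a by move/hN.
    rewrite /F /= exprD mulrC -scalerA scalerA mulrC -scalerA -/w.
    have -> : x ^+ l *: (a *: w) = - (x ^+ l *: c).
      by apply/eqP; rewrite -addr_eq0 addrC -scalerDr hl.
    by rewrite -scaleN1r scalerA; exact: (CZ).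
apply: (@gproj_ind _ _ (gmod_grading E) (fun y => torsion K (r y))).
- by rewrite linear0; exact: torsion0.
- by move=> u v; rewrite linearD; exact: torsionD.
- by move=> n; apply: (hom n); exact: gproj_in.
Qed.

End TorsionRetraction.

(** * The Koszul complex *)

Section Koszul.
Variable R : graded_ring.
Implicit Types (M N E X : graded_module R).

Definition homogeneous_of_degree M N (n : int) (f : {linear M -> N}) :=
  forall k v, gmod_comp k v -> gmod_comp (k + n) (f v).

(** The map [f] factors through the image of [u], a graded submodule of [N]; shifting by [n] turns
    the factored map into a homogeneous one, to which graded injectivity applies. *)
Lemma injective_extension E X N (n : int) (u : {linear X -> N})
    (f : {linear X -> E}) : graded_injective E ->
  homogeneous_map u -> homogeneous_of_degree n f ->
  (forall z, u z = 0 -> f z = 0) ->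
  exists g : {linear N -> E}, homogeneous_of_degree n g /\ forall z, g (u z) = f z.
Proof.
move=> injE hu hf kuf.
pose P : N -> Prop := fun y => exists z, u z = y.
have P0 : P 0 by exists 0; exact: linear0.
have PD x y : P x -> P y -> P (x + y).
  by move=> [a <-] [b <-]; exists (a + b); exact: linearD.
have PZ a x : P x -> P (a *: x).
  by move=> [b <-]; exists (a *: b); exact: linearZ_LR.
have Pg k x : P x -> P (gcomp k x).
  by move=> [b <-]; exists (gcomp k b); rewrite gcomp_hom.
pose B := GradedSubmodule P0 PD PZ Pg.
have kE z z' : u z = u z' -> f z = f z'.
  move=> e; apply/eqP; rewrite -subr_eq0 -linearB; apply/eqP/kuf.
  by rewrite linearB e subrr.
pose pre (b : gsubmod B) : X := sval (cid (gsub_mem_val b)).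
have preP b : u (pre b) = gsub_incl B b by rewrite /pre; case: cid.
have lin : linear (fun b : gshift (gsubmod B) n => f (pre b)).
  by move=> a x y; rewrite -linearP; apply: kE; rewrite !linearP !preP linearP.
have hi : homogeneous_map
    (gsub_incl B : {linear gshift (gsubmod B) n -> gshift N n}).
  by apply/homogeneousP.
have hfB : homogeneous_map (lin_of lin : {linear gshift (gsubmod B) n -> E}).
  apply/homogeneousP => k b hb.
  (* The chosen preimage need not be homogeneous, but its component of degree [k - n] has the same
     image under [u], hence under [f]. *)
  have e : f (gcomp (k - n) (pre b)) = f (pre b).
    by apply: kE; rewrite -gcomp_hom // preP; apply/gcomp_id; exact: hb.
  by have := hf _ _ (gcomp_in (k - n) (pre b)); rewrite e subrK.
have [g [hg gP]] := injE _ _ _ _ hi (@gsub_incl_inj _ _ B) hfB.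
exists g; split=> [k v hv|z].
  by have /homogeneousP := hg; apply; rewrite /= /shift_comp addrK.
have Puz : u z \in gsub_pred B by apply/asboolP; exists z.
by apply: (etrans (gP (GSub Puz))); apply: kE; rewrite preP.
Qed.

Fact gfree_scale m n (r : R) (x : R^o) :
  gring_comp m r -> @gring_comp R n x -> @gring_comp R (m + n) (r *: x).
Proof. exact: gring_mul. Qed.

Definition gfree : graded_module R :=
  @GradedModule R R^o (@gring_comp R) (gring_grading R) gfree_scale.

(* All homological degrees at once: (a, b) stands for a + b e_x, where e_x is
   the exterior generator of x, of internal degree 1. *)
Fixpoint koszul (xs : seq R) : graded_module R :=
  if xs is _ :: s then gsum (koszul s) (gshift (koszul s) 1) else gfree.

(** The sign is that of [e_x] written in front, d(e_x b) = x b - e_x d(b); it does not depend on the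
    homological degree of [b], so all degrees are treated at once. *)
Fixpoint bd_fun (xs : seq R) : koszul xs -> koszul xs :=
  if xs is x :: s return koszul xs -> koszul xs then
    fun v : (koszul s * koszul s)%type => (bd_fun v.1 + x *: v.2, - bd_fun v.2)
  else fun=> 0.

Fact bd_linear xs : linear (@bd_fun xs).
Proof.
elim: xs => [|x s IHs] /= a u v; first by rewrite scaler0 addr0.
have lin b y z : bd_fun (b *: y + z) = b *: @bd_fun s y + bd_fun z by exact: IHs.
congr (_, _) => /=.
  by rewrite lin !scalerDr !scalerA mulrC addrACA.
by rewrite lin opprD scalerN.
Qed.

Definition bd xs : {linear koszul xs -> koszul xs} := lin_of (@bd_linear xs).

Lemma bd_cons x s a b :
  bd (x :: s) (a, b) = (bd s a + x *: b, - bd s b).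
Proof. by []. Qed.

Fixpoint kpart_fun (xs : seq R) : int -> koszul xs -> koszul xs :=
  if xs is x :: s return int -> koszul xs -> koszul xs then
    fun j (v : (koszul s * koszul s)%type) =>
      (kpart_fun j v.1, kpart_fun (j - 1) v.2)
  else fun j v => if j == 0 then v else 0.

Fact kpart_linear xs j : linear (@kpart_fun xs j).
Proof.
elim: xs j => [|x s IHs] j /= a u v.
  by case: ifP => // _; rewrite scaler0 addr0.
have lin i b y z : kpart_fun i (b *: y + z) = b *: @kpart_fun s i y + kpart_fun i z.
  exact: IHs.
by congr (_, _) => /=; rewrite lin.
Qed.

(* The projection onto the part of homological degree j. *)
Definition kpart xs j : {linear koszul xs -> koszul xs} :=
  lin_of (@kpart_linear xs j).

Lemma kpart_nil j v : kpart [::] j v = if j == 0 then v else 0.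
Proof. by []. Qed.

Lemma kpart_cons x s j a b :
  kpart (x :: s) j (a, b) = (kpart s j a, kpart s (j - 1) b).
Proof. by []. Qed.

Lemma kpart_idem xs j v : kpart xs j (kpart xs j v) = kpart xs j v.
Proof.
elim: xs j v => [|x s IHs] j v; last first.
  by case: v => a b; rewrite kpart_cons kpart_cons IHs IHs.
by rewrite !kpart_nil; case: (j == 0).
Qed.

Lemma kpart_lt0 xs (j : int) v : (j < 0)%R -> kpart xs j v = 0.
Proof.
elim: xs j v => [|x s IHs] j v j0.
  by rewrite kpart_nil; case: eqP => // e; rewrite e in j0.
by case: v => a b; rewrite kpart_cons !IHs //; lia.
Qed.

Lemma kpart_bd xs j v : bd xs (kpart xs j v) = kpart xs (j - 1) (bd xs v).
Proof.
elim: xs j v => [|x s IHs] j v; first by rewrite linear0.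
case: v => a b; rewrite kpart_cons !bd_cons kpart_cons.
by rewrite linearD linearZ_LR !IHs linearN.
Qed.

Lemma kpart_hom xs j : homogeneous_map (kpart xs j).
Proof.
apply/homogeneousP; elim: xs j => [|x s IHs] j n v.
  by rewrite kpart_nil; case: ifP => // _ _; exact: (homog0 (gring_grading R)).
by case: v => a b; rewrite kpart_cons => -[ha hb]; split; exact: IHs.
Qed.

Lemma bd_hom xs : (forall x, x \in xs -> gring_comp 1 x) ->
  homogeneous_map (bd xs).
Proof.
move=> deg1; apply/homogeneousP; elim: xs deg1 => [|x s IHs] deg1 n v.
  by move=> _; exact: (homog0 (gring_grading R)).
have {}IHs : forall k y, gmod_comp k y -> gmod_comp k (bd s y).
  by apply: IHs => z zs; apply: deg1; rewrite inE zs orbT.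
case: v => a b [ha hb]; rewrite bd_cons; split.
  apply: (homogD (gmod_grading _)); first exact: IHs.
  have hb' : @gmod_comp R (koszul s) (n - 1) b := hb.
  by have := gmod_scale (deg1 x (mem_head _ _)) hb'; rewrite addrC subrK.
by apply: (homogN (gmod_grading _)); exact: IHs hb.
Qed.

(** The homotopy is exterior multiplication on the left by [e_x], which accounts for the sign when
    it passes another generator. Consequently [x] annihilates the Koszul homology. *)
Lemma bd_homotopy xs x : x \in xs -> exists h : {linear koszul xs -> koszul xs},
  forall v, bd xs (h v) + h (bd xs v) = x *: v.
Proof.
elim: xs => // y s IHs; rewrite inE => /orP[/eqP <-|/IHs[h hP]].
  have lin : linear (fun v : koszul (x :: s) => (0, v.1) : koszul (x :: s)).
    by move=> a u v; congr (_, _); rewrite /= ?scaler0 ?addr0.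
  pose h : {linear koszul (x :: s) -> koszul (x :: s)} := lin_of lin.
  have hE c d : h (c, d) = (0, c) by [].
  exists h => -[a b]; rewrite hE !bd_cons hE; congr (_, _) => /=.
    by rewrite linear0 add0r addr0.
  by rewrite addKr.
have lin : linear (fun v : koszul (y :: s) => (h v.1, - h v.2) : koszul (y :: s)).
  by move=> a u v; congr (_, _) => /=; rewrite linearP // opprD scalerN.
pose h' : {linear koszul (y :: s) -> koszul (y :: s)} := lin_of lin.
have hE c d : h' (c, d) = (h c, - h d) by [].
exists h' => -[a b]; rewrite hE !bd_cons hE; congr (_, _) => /=.
  by rewrite linearD linearZ_LR scalerN -(hP a) addrACA addNr addr0.
by rewrite !linearN !opprK hP.
Qed.

Lemma bdK xs v : bd xs (bd xs v) = 0.
Proof.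
elim: xs v => [|x s IHs] v //; case: v => a b; rewrite !bd_cons linearD IHs.
congr (_, _) => /=; first by rewrite add0r linearZ_LR scalerN subrr.
by rewrite linearN IHs !oppr0.
Qed.

(* A form of the inclusion [bd (koszul xs) <= (xs) koszul xs]. *)
Lemma bd_ind xs (V : lmodType R) (g : {linear koszul xs -> V}) (P : V -> Prop) :
  P 0 -> (forall u v, P u -> P v -> P (u + v)) ->
  (forall x q, x \in xs -> P (x *: g q)) -> forall k, P (g (bd xs k)).
Proof.
move=> P0 PD; elim: xs g => [|x s IHs] g Px k; first by rewrite linear0.
have l1 : linear (fun a : koszul s => g ((a, 0) : koszul (x :: s))).
  move=> a u v; rewrite -linearP; congr (g _).
  by congr (_, _); rewrite /= scaler0 addr0.
have l2 : linear (fun a : koszul s => g ((0, a) : koszul (x :: s))).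
  move=> a u v; rewrite -linearP; congr (g _).
  by congr (_, _); rewrite /= scaler0 addr0.
case: k => a b; rewrite bd_cons.
have -> : ((bd s a + x *: b, - bd s b) : koszul (x :: s)) =
    (bd s a, 0) + x *: ((b, 0) : koszul (x :: s)) + (0, bd s (- b)).
  by congr (_, _) => /=; rewrite ?addr0 ?scaler0 ?add0r ?linearN.
rewrite !linearD linearZ_LR; apply: (PD); first apply: (PD).
- apply: (IHs (lin_of l1)) => y q ys; rewrite /lin_of; apply: Px.
  by rewrite inE ys orbT.
- by apply: Px; exact: mem_head.
- apply: (IHs (lin_of l2)) => y q ys; rewrite /lin_of; apply: Px.
  by rewrite inE ys orbT.
Qed.

(** The coefficient of the product of all exterior generators. This product has internal degree
    [size xs], so the functional lowers degrees by that amount. *)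
Fixpoint ktop_fun (xs : seq R) : koszul xs -> R^o :=
  if xs is x :: s return koszul xs -> R^o then
    fun v : (koszul s * koszul s)%type => ktop_fun v.2
  else fun v => v.

Fact ktop_linear xs : linear (@ktop_fun xs).
Proof. by elim: xs => [|x s IHs] //= a u v; exact: IHs. Qed.

Definition ktop xs : {linear koszul xs -> R^o} := lin_of (@ktop_linear xs).

Fixpoint ktop_elt (xs : seq R) : koszul xs :=
  if xs is x :: s return koszul xs then (0, ktop_elt s) else (1 : R).

Lemma ktop_eltE xs : ktop xs (ktop_elt xs) = 1.
Proof. by elim: xs. Qed.

Lemma ktop_bd x s v : ktop (x :: s) (bd (x :: s) v) = 0.
Proof.
elim: s x v => [|y s IHs] x [a b]; rewrite bd_cons.
  by rewrite -[LHS]/(- (0 : R)) oppr0.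
by rewrite -[LHS]/(ktop (y :: s) (- bd (y :: s) b)) linearN IHs oppr0.
Qed.

Lemma ktop_kpart xs v : ktop xs (kpart xs (size xs)%:Z v) = ktop xs v.
Proof.
elim: xs v => // x s IHs [a b]; rewrite kpart_cons.
rewrite -[LHS]/(ktop s (kpart s ((size s).+1%:Z - 1) b)).
have -> : (size s).+1%:Z - 1 = (size s)%:Z :> int by lia.
exact: IHs.
Qed.

Lemma ktop_hom xs k v : @gmod_comp _ (koszul xs) k v ->
  @gring_comp R (k - (size xs)%:Z) (ktop xs v).
Proof.
elim: xs k v => [|x s IHs] k; first by move=> v; rewrite subr0.
case=> a b [_ hb]; have := IHs _ _ hb.
by rewrite -addrA -opprD -PoszD.
Qed.

(** The Koszul complex is free on homogeneous elements of degrees >= 0, so only values of [f] in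
    degrees at least [n] have to be lifted. *)
Lemma koszul_lift M N (g : {linear M -> N}) xs n (f : {linear koszul xs -> N}) :
  homogeneous_of_degree n f ->
  (forall k v, n <= k -> gmod_comp k (f v) ->
     exists2 u, gmod_comp k u & g u = f v) ->
  exists f' : {linear koszul xs -> M},
    homogeneous_of_degree n f' /\ forall v, g (f' v) = f v.
Proof.
elim: xs n f => [|x s IHs] n f hf lift.
  have h1 : gmod_comp n (f (1 : R)).
    by rewrite -[n]add0r; apply: hf; exact: gring_one.
  have [u hu gu] := lift n _ (lexx _) h1.
  have lin : linear (fun a : koszul [::] => (a : R) *: u).
    by move=> a b c; rewrite scalerDl scalerA.
  exists (lin_of lin); split=> [k v hv|v]; first exact: gmod_scale.
  rewrite /lin_of linearZ_LR gu -linearZ_LR; congr (f _).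
  exact: mulr1.
have l1 : linear (fun a : koszul s => f ((a, 0) : koszul (x :: s))).
  move=> a u v; rewrite -linearP; congr (f _).
  by congr (_, _); rewrite /= scaler0 addr0.
have l2 : linear (fun a : koszul s => f ((0, a) : koszul (x :: s))).
  move=> a u v; rewrite -linearP; congr (f _).
  by congr (_, _); rewrite /= scaler0 addr0.
have [k v hv|k v nk hv|f1 [hf1 g1]] := IHs n (lin_of l1).
- by apply: hf; split=> //; exact: (homog0 (gmod_grading _)).
- exact: (lift k (v, 0)).
(* On the summand of [e_x], itself of degree 1, [f] becomes a map of degree [n + 1]. *)
have [k v hv|k v nk hv|f2 [hf2 g2]] := IHs (n + 1) (lin_of l2).
- rewrite [n + 1]addrC addrA; apply: hf; split.
    exact: (homog0 (gmod_grading _)).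
  by rewrite /= /shift_comp addrK.
- by apply: (lift k (0, v)) => //; lia.
have lin : linear (fun v : koszul (x :: s) => f1 v.1 + f2 v.2).
  by move=> a u v; rewrite !linearP scalerDr addrACA.
exists (lin_of lin); split=> [k [a b] [ha hb]|[a b]].
  apply: (homogD (gmod_grading _)); first exact: hf1.
  by have := hf2 _ _ hb; rewrite [n + 1]addrC addrA subrK.
have -> : f (a, b) = f ((a, 0) : koszul (x :: s)) + f (0, b).
  by rewrite -linearD; congr (f _); congr (_, _); rewrite /= ?addr0 ?add0r.
by rewrite -[LHS]/(g (f1 a + f2 b)) linearD g1 g2.
Qed.

End Koszul.

(** * Dimension shifting *)

Section DimensionShifting.
Variables (R : graded_ring) (xs : seq R) (K : ideal R).
Hypothesis noeth : noetherian R.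
Hypothesis deg1 : forall x, x \in xs -> gring_comp 1 x.
Hypothesis xsK : generates xs K.
Variables (M : graded_module R) (E : injective_resolution M).
Hypothesis vanishing : forall i : nat, exists n0 : int, forall n : int,
  n0 <= n -> local_cohomology_vanishes K E i n.

Let retraction i := torsion_retraction noeth deg1 xsK (@res_injective _ _ E i).

Let r i : {linear res_obj E i -> res_obj E i} := sval (cid (retraction i)).

Let r_hom i : homogeneous_map (r i).
Proof. by rewrite /r; case: cid => f []. Qed.

Let r_id i y : torsion K y -> r i y = y.
Proof. by rewrite /r; case: cid => f [_ + _] /=; exact. Qed.

Let r_torsion i y : torsion K (r i y).
Proof. by rewrite /r; case: cid => f [_ _] /=; exact. Qed.

(* The projection onto a torsion-free direct summand of [res_obj E i] and the
   differentials induced on these summands. *)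
Let p i : {linear res_obj E i -> res_obj E i} := idfun \- r i.

Let D i : {linear res_obj E i -> res_obj E i.+1} := p i.+1 \o res_diff E i.

Let pE i y : p i y = y - r i y. Proof. by []. Qed.

Let DE i y : D i y = p i.+1 (res_diff E i y). Proof. by []. Qed.

Let p_torsion i y : torsion K y -> p i y = 0.
Proof. by move=> ty; rewrite pE r_id // subrr. Qed.

Let p_eq0 i y : p i y = 0 -> torsion K y.
Proof. by rewrite pE => /eqP; rewrite subr_eq0 => /eqP ->. Qed.

Let p_idem i y : p i (p i y) = p i y.
Proof. by rewrite [p i y in LHS]pE linearB (p_torsion (r_torsion _)) subr0. Qed.

Let p_hom i : homogeneous_map (p i).
Proof.
apply/homogeneousP => n y hy; apply: (homogB (gmod_grading _)) => //.
by have /homogeneousP := @r_hom i; apply.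
Qed.

Let D_hom i : homogeneous_map (D i).
Proof.
apply/homogeneousP => n y hy; have /homogeneousP := @p_hom i.+1; apply.
by have /homogeneousP := @res_diff_homogeneous _ _ E i; apply.
Qed.

(** Differentials preserve torsion and [p] kills it, so [D] depends only on the class modulo
    torsion. *)
Let Dp i y : D i (p i y) = D i y.
Proof.
have e : p i.+1 (res_diff E i (r i y)) = 0.
  exact/p_torsion/torsion_linear/r_torsion.
by rewrite !DE [p i y]pE linearB [LHS]linearB e subr0.
Qed.

Let pD i y : p i.+1 (D i y) = D i y.
Proof. exact: p_idem. Qed.

Let DD i y : D i.+1 (D i y) = 0.
Proof.
rewrite [D i y]DE Dp DE.
suff -> : res_diff E i.+1 (res_diff E i y) = 0 by rewrite linear0.
by apply/res_exactS; exists y.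
Qed.

(** A cocycle [y] of F^(i+1) has torsion image in E^(i+2). Vanishing of local cohomology at [i.+2]
    makes this image the differential of a torsion [t]; then [y - t] is a boundary in E, and [p]
    erases [t]. *)
Let D_exact i : exists N : int, forall n y, N <= n -> gmod_comp n y ->
  p i.+1 y = y -> D i.+1 y = 0 -> exists2 w, gmod_comp n w & D i w = y.
Proof.
have [N hN] := vanishing i.+2; exists N => n y Nn hy py Dy.
have [|t tt dt] := hN n Nn (res_diff E i.+1 y).
  split; last by have /homogeneousP := @res_diff_homogeneous _ _ E i.+1; apply.
  by split; [exact: p_eq0 | apply/res_exactS; exists y].
have /res_exactS[w dw] : res_diff E i.+1 (y - t) = 0.
  by rewrite linearB dt subrr.
exists (gcomp n w); first exact: gcomp_in.
rewrite -(gcomp_hom _ _ (@D_hom i)) DE dw linearB py (p_torsion tt) subr0.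
exact: gcomp_id.
Qed.

Let aug_exact : exists N : int, forall n y, N <= n -> gmod_comp n y ->
  p 0 y = y -> D 0 y = 0 -> exists2 m, gmod_comp n m & p 0 (res_aug E m) = y.
Proof.
have [N hN] := vanishing 1; exists N => n y Nn hy py Dy.
have [|t tt dt] := hN n Nn (res_diff E 0 y).
  split; last by have /homogeneousP := @res_diff_homogeneous _ _ E 0; apply.
  by split; [exact: p_eq0 | apply/res_exactS; exists y].
have /res_exact0[w dw] : res_diff E 0 (y - t) = 0 by rewrite linearB dt subrr.
exists (gcomp n w); first exact: gcomp_in.
rewrite -(gcomp_hom _ _ (@res_aug_homogeneous _ _ E)) -(gcomp_hom _ _ (@p_hom 0)).
by rewrite dw linearB py (p_torsion tt) subr0; exact: gcomp_id.
Qed.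

(** The kernel of M -> F^0 maps injectively to the torsion cocycles of E^0, which vanish in high
    degrees by the case [i = 0] of the hypothesis. *)
Let aug_inj : exists N : int, forall n m, N <= n -> gmod_comp n m ->
  p 0 (res_aug E m) = 0 -> m = 0.
Proof.
have [N hN] := vanishing 0; exists N => n m Nn hm pm.
have /res_aug_inj : res_aug E m = res_aug E 0; last by [].
rewrite linear0; apply: (hN n Nn); split.
  by split; [exact: p_eq0 | apply/res_exact0; exists m].
by have /homogeneousP := @res_aug_homogeneous _ _ E; apply.
Qed.

(* Duality for the injective, torsion-free summand: a cocycle of
   Hom(koszul xs, _) kills the cycles of the Koszul complex, since (xs)
   annihilates its homology, so it extends along [bd]. *)
Let column_exact i n (c : {linear koszul xs -> res_obj E i}) :
  homogeneous_of_degree n c -> (forall v, p i (c v) = c v) ->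
  (forall v, c (bd xs v) = 0) ->
  exists b : {linear koszul xs -> res_obj E i},
    [/\ homogeneous_of_degree n b, forall v, p i (b v) = b v &
        forall v, b (bd xs v) = c v].
Proof.
move=> hc pc cbd.
have kerc z : bd xs z = 0 -> c z = 0.
  move=> bz; rewrite -pc; apply/p_torsion/(torsionP xsK) => x xK; exists 1%N.
  have [h hP] := bd_homotopy xK.
  by rewrite expr1 -linearZ_LR -hP bz linear0 addr0 cbd.
have [b [hb bP]] :=
  injective_extension (@res_injective _ _ E i) (bd_hom deg1) hc kerc.
exists (p i \o b); split=> [k v hv|v|v].
- by have /homogeneousP := @p_hom i; apply; exact: hb.
- exact: p_idem.
- by rewrite -[LHS]/(p i (b (bd xs v))) bP pc.
Qed.

(** A diagram chase in the double complex Hom(koszul xs, F): columns are exact by [column_exact],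
    rows in high degrees by [D_exact]. A primitive [b] of [c] along [bd] is corrected until [D]
    kills it; the defect [D i \o b] has Koszul degree one less and lives on F^(i+1). *)
Let koszul_exact (j i : nat) : exists N : int,
  forall n (c : {linear koszul xs -> res_obj E i}), N <= n ->
  homogeneous_of_degree n c -> (forall v, c (kpart xs (j%:Z - 1) v) = c v) ->
  (forall v, p i (c v) = c v) -> (forall v, D i (c v) = 0) ->
  (forall v, c (bd xs v) = 0) ->
  exists b : {linear koszul xs -> res_obj E i},
    [/\ homogeneous_of_degree n b, forall v, p i (b v) = b v,
        forall v, D i (b v) = 0 & forall v, b (bd xs v) = c v].
Proof.
elim: j i => [|j IHj] i.
  (* The Koszul degree is [j - 1], so the induction starts in degree -1, where [c] is zero. *)
  exists 0 => n c _ hc cj pc Dc cbd; exists c; split=> // v.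
  by rewrite cbd -cj kpart_lt0 ?linear0.
have [N1 hN1] := IHj i.+1; have [N2 hN2] := D_exact i.
exists (Num.max N1 N2) => n c; rewrite ge_max => /andP[N1n N2n] hc cj pc Dc cbd.
have [b0 [hb0 pb0 b0P]] := column_exact hc pc cbd.
(* Cutting down to a single Koszul degree makes the induction hypothesis applicable to [D i \o b].
   It preserves [b \o bd = c], as [c] is concentrated one degree higher. *)
pose b : {linear koszul xs -> res_obj E i} := b0 \o kpart xs (j%:Z - 1).
have jE : j.+1%:Z - 1 = j%:Z by lia.
have bP v : b (bd xs v) = c v.
  by rewrite /b /= -kpart_bd b0P -jE cj.
have hb : homogeneous_of_degree n b.
  move=> k v hv; apply: hb0.
  by have /homogeneousP := @kpart_hom _ xs (j%:Z - 1); apply.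
have [||v|v|v|v|b' [hb' pb' Db' b'P]] := hN1 n (D i \o b).
- exact: N1n.
- by move=> k v hv; have /homogeneousP := @D_hom i; apply; exact: hb.
- by rewrite /b /= kpart_idem.
- exact: pD.
- exact: DD.
- by rewrite -[LHS]/(D i (b (bd xs v))) bP.
have [|b'' [hb'' b''P]] := koszul_lift (g := D i) hb'.
  move=> k v nk hv; apply: hN2 => //; exact: le_trans nk.
(* As [D i \o b''] is [b'] and [b' \o bd] is [D i \o b], the correction cancels [D i \o b]; it
   vanishes on boundaries because [bd] squares to zero. *)
exists (b \- (p i \o (b'' \o bd xs))); split=> [k v hv|v|v|v].
- apply: (homogB (gmod_grading _)); first exact: hb.
  have /homogeneousP := @p_hom i; apply; apply: hb''.
  by have /homogeneousP := bd_hom deg1; apply.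
- by rewrite -[X in p i X]/(b v - p i (b'' (bd xs v))) linearB p_idem pb0.
- by rewrite -[X in D i X]/(b v - p i (b'' (bd xs v))) linearB Dp b''P b'P subrr.
- rewrite -[LHS]/(b (bd xs v) - p i (b'' (bd xs (bd xs v)))) bdK.
  by rewrite (linear0 b'') (linear0 (p i)) subr0.
Qed.

(** The predicate [Q] stands for membership in the submodule (xs) M: the conclusion is that M / (xs)
    M vanishes in degrees >= N. *)
Theorem eventually_generated : xs != [::] -> exists N : int,
  forall n (u : M) (Q : M -> Prop), N <= n -> gmod_comp n u ->
  Q 0 -> (forall v w, Q v -> Q w -> Q (v + w)) ->
  (forall x m, x \in xs -> Q (x *: m)) -> Q u.
Proof.
move=> xs0.
have [N0 hN0] := aug_exact; have [N1 hN1] := aug_inj.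
have [N2 hN2] := koszul_exact (size xs).+1 0.
(* [N0 + 1] because elements of degree [n - 1] are lifted to M, and [N2 + size xs] because the
   cochain [c] has degree [n - size xs]. *)
exists (Num.max (N0 + 1) (Num.max N1 (N2 + (size xs)%:Z))) => n u Q.
rewrite !ge_max => /and3P[nN0 nN1 nN2] hu Q0 QD Qx.
have aug_hom k m : gmod_comp k m -> gmod_comp k (p 0 (res_aug E m)).
  move=> hm; have /homogeneousP := @p_hom 0; apply.
  by have /homogeneousP := @res_aug_homogeneous _ _ E; apply.
pose w := p 0 (res_aug E u).
have lin : linear (fun v : koszul xs => (ktop xs v : R) *: w).
  by move=> a v z; rewrite linearP scalerDl scalerA.
pose c : {linear koszul xs -> res_obj E 0} := lin_of lin.
have cE v : c v = (ktop xs v : R) *: w by [].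
have [||v|v|v|v|b [_ pb Db bP]] := hN2 (n - (size xs)%:Z) c.
- by rewrite lerBrDr.
- move=> k v /ktop_hom hv; rewrite cE addrA addrAC.
  by apply: gmod_scale => //; exact: aug_hom.
- have -> : (size xs).+1%:Z - 1 = (size xs)%:Z by lia.
  by rewrite !cE ktop_kpart.
- by rewrite cE linearZ_LR p_idem.
- rewrite cE linearZ_LR /w Dp DE.
  have -> : res_diff E 0 (res_aug E u) = 0 by apply/res_exact0; exists u.
  by rewrite linear0 scaler0.
- by rewrite cE; case: (xs) xs0 v => // x s _ v; rewrite ktop_bd scale0r.
(* The boundary is a combination of terms [x *: q]. Since [b q] lies in the kernel of [D 0], its
   component of degree [n - 1] comes from M, so [x *: b q] contributes in degree [n] the image of an
   element of (xs) M. *)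
have [m [hm Qm mE]] : exists m, [/\ gmod_comp n m, Q m &
    p 0 (res_aug E m) = gcomp n (b (bd xs (ktop_elt xs)))].
  apply: (bd_ind (P := fun v => exists m, [/\ gmod_comp n m, Q m &
      p 0 (res_aug E m) = gcomp n v])).
  - exists 0; split=> //; first exact: (homog0 (gmod_grading _)).
    by rewrite !linear0 /gcomp gproj0.
  - move=> v v' [m [hm Qm mE]] [m' [hm' Qm' mE']]; exists (m + m'); split.
    + exact: (homogD (gmod_grading _)).
    + exact: QD.
    + by rewrite !linearD mE mE' gcompD.
  - move=> x q xK; have [||||m hm mE] := hN0 (n - 1) (gcomp (n - 1) (b q)).
    + by rewrite lerBrDr.
    + exact: gcomp_in.
    + by rewrite -(gcomp_hom _ _ (@p_hom 0)) pb.
    + apply: etrans (esym (gcomp_hom (n - 1) (b q) (@D_hom 0))) _.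
      by rewrite Db; exact: gproj0.
    exists (x *: m); split.
    + by have := gmod_scale (deg1 xK) hm; rewrite addrC subrK.
    + exact: Qx.
    + by rewrite !linearZ_LR mE -(gcomp_scale _ _ (deg1 xK)) subrK.
suff -> : u = m by [].
apply/eqP; rewrite -subr_eq0; apply/eqP/(hN1 n) => //.
  exact: (homogB (gmod_grading _)).
rewrite (linearB (res_aug E)) (linearB (p 0)) mE bP cE ktop_eltE scale1r.
rewrite gcomp_id ?subrr //.
exact: aug_hom.
Qed.

End DimensionShifting.

(** * Integral dependence and generators of Rees algebras *)

Section IdealPowers.
Variable A : comNzRingType.
Implicit Types (I H : ideal A).

Lemma idealN I x : I x -> I (- x).
Proof. by rewrite -mulN1r; exact: idealM. Qed.

Lemma ideal_exp1 I x : I x -> ideal_exp I 1 x.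
Proof. by move=> Ix; rewrite -[x]mulr1; exact: ideal_mulI. Qed.

Lemma ideal_exp_le I m n : (m <= n)%N -> ideal_exp I n `<=` ideal_exp I m.
Proof.
move=> /subnKC <-; elim: (n - m)%N => [|k IHk]; first by rewrite addn0.
rewrite addnS => x [s [hs ->]]; apply: ideal_sum => p /hs[_ h2].
by apply/idealM/IHk.
Qed.

Lemma ideal_exp_pow I x n : I x -> ideal_exp I n (x ^+ n).
Proof.
by move=> Ix; elim: n => [//|n IHn]; rewrite exprS; exact: ideal_mulI.
Qed.

End IdealPowers.

Section DeterminantTrick.
Variables (A : comNzRingType) (I : ideal A).

(** Weight at least [d], when the variable has weight 1 and elements of the j-th power of [I] have
    weight j. Beyond [d] the truncated subtraction gives the unit ideal, that is, no condition. *)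
Definition weighted (d : nat) (q : {poly A}) :=
  forall k : nat, ideal_exp I (d - k) q`_k.

Lemma weighted_sum d (T : Type) (s : seq T) (P : pred T) (f : T -> {poly A}) :
  (forall t, P t -> weighted d (f t)) -> weighted d (\sum_(t <- s | P t) f t).
Proof.
move=> h k; rewrite coef_sum; elim/big_ind: _; first exact: ideal0.
  exact: idealD.
by move=> t Pt; exact: h.
Qed.

Lemma weightedM d e p q : weighted d p -> weighted e q -> weighted (d + e) (p * q).
Proof.
move=> hp hq k; rewrite coefM; apply: ideal_sum => i _.
apply: (ideal_exp_le _ (ideal_expD (hp i) (hq (k - i)%N))).
by have := ltn_ord i; lia.
Qed.

Lemma weighted_prod n (f : 'I_n -> {poly A}) :
  (forall i, weighted 1 (f i)) -> weighted n (\prod_i f i).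
Proof.
elim: n f => [|n IHn] f hf; first by move=> k; rewrite sub0n.
rewrite big_ord_recl.
exact: (weightedM (hf ord0) (IHn _ (fun i => hf (lift ord0 i)))).
Qed.

Lemma char_poly_weighted n (B : 'M[A]_n) :
  (forall i j, I (B i j)) -> weighted n (char_poly B).
Proof.
move=> hB; apply: weighted_sum => s _; rewrite mulr_sign.
have h : weighted n (\prod_i char_poly_mx B i (s i)).
  apply: weighted_prod => i k; rewrite !mxE coefB coefC coefMn coefX.
  case: k => [|k]; last by [].
  rewrite mul0rn sub0r; apply/ideal_exp1/idealN; exact: hB.
by case: ifP => // _ k; rewrite coefN; apply/idealN/h.
Qed.

Lemma det_horner n (B : 'M[A]_n) z : \det (z%:M - B) = (char_poly B).[z].
Proof.
rewrite -horner_evalE -det_map_mx; congr (\det _); apply/matrixP => i j.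
by rewrite !mxE /= horner_evalE !hornerE hornerMn hornerX.
Qed.

Lemma mul_fg_coef n (g : 'I_n -> A) (H : ideal A) x :
  (forall y, H y -> exists c : 'I_n -> A, y = \sum_i c i * g i) ->
  ideal_mul I H x ->
  exists b : 'I_n -> A, (forall i, I (b i)) /\ x = \sum_i b i * g i.
Proof.
move=> hH [s [hs ->]]; elim: s hs => [|[u v] s IHs] hs.
  exists (fun=> 0); split=> [i|]; first exact: ideal0.
  by rewrite big_nil big1 // => i _; rewrite mul0r.
have [p ps|b [hb bE]] := IHs; first by apply: hs; rewrite inE ps orbT.
have [/= Iu /hH[c ->]] := hs (u, v) (mem_head _ _).
exists (fun i => u * c i + b i); split=> [i|].
  by apply: idealD => //; rewrite mulrC; exact: idealM.
rewrite big_cons bE mulr_sumr -big_split.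
by apply: eq_bigr => i _; rewrite mulrDl mulrA.
Qed.

Lemma reduction_integral (J : ideal A) k : finitely_generated (ideal_exp J k) ->
  ideal_exp J k.+1 `<=` ideal_mul I (ideal_exp J k) -> J `<=` integral_closure I.
Proof.
move=> [n [g hg]] red z Jz.
have Hg i : ideal_exp J k (g i).
  apply/hg; exists (fun j => (j == i)%:R).
  by rewrite (bigD1 i) //= eqxx mul1r big1 ?addr0 // => j /negbTE ->; rewrite mul0r.
have /choice[B hB] i : exists b : 'I_n -> A,
    (forall j, I (b j)) /\ z * g i = \sum_j b j * g j.
  apply: (@mul_fg_coef _ g (ideal_exp J k)) => [y /hg//|].
  by apply: red; exact: ideal_mulI.
pose BM : 'M[A]_n := \matrix_(i, j) B i j.
have BMI i j : I (BM i j) by rewrite mxE; case: (hB i).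
pose q := char_poly BM.
have qg i : q.[z] * g i = 0.
  have e : (z%:M - BM) *m (\col_i g i) = 0.
    apply/matrixP => a b; rewrite mulmxBl mul_scalar_mx !mxE.
    have [_ ->] := hB a; rewrite -sumrB big1 // => j _.
    by rewrite !mxE subrr.
  have := congr1 (mulmx (\adj (z%:M - BM))) e.
  rewrite mulmxA mul_adj_mx mul_scalar_mx mulmx0 det_horner.
  by move=> /matrixP/(_ i 0); rewrite !mxE.
(* [q.[z]] kills the generators of the k-th power of [J], hence a power of [z]. The exponent [k.+1]
   instead of [k] makes the final degree [n + k + 1] positive even when [n] and [k] are 0. *)
have qz : q.[z] * z ^+ k.+1 = 0.
  have [c e] := (hg _).1 (idealM z (ideal_exp_pow k Jz)).
  rewrite exprS e mulr_sumr big1 // => i _.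
  by rewrite mulrCA qg mulr0.
(* These are the coefficients of [q * 'X^k.+1]; without the test, [n - i] would be 0 for [i > n] and
   repeat the constant term of [q]. *)
exists (n + k).+1, (fun i => if (i <= n)%N then q`_(n - i) else 0).
split=> // [i _|].
  case: ifP => [le_in|_]; last exact: ideal0.
  by have := char_poly_weighted BMI (n - i)%N; rewrite subKn.
have size_q : size q = n.+1 := size_char_poly BM.
have qn : q`_n = 1.
  by have /monicP := char_poly_monic BM; rewrite lead_coefE -/q size_q.
have e : \sum_(0 <= i < n.+1) q`_(n - i) * z ^+ ((n + k).+1 - i) = 0.
  apply: etrans qz; rewrite horner_coef size_q mulr_suml.
  rewrite -(big_mkord xpredT (fun i => q`_i * z ^+ i * z ^+ k.+1)) [RHS]big_nat_rev.
  apply: eq_big_nat => i /andP[_ hi]; rewrite add0n subSS -mulrA -exprD.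
  by congr (_ * _ ^+ _); lia.
rewrite big_nat_recl // !subn0 qn mul1r in e; rewrite -[RHS]e; congr (_ + _).
rewrite (big_cat_nat (n := n.+1)) //=; last by lia.
rewrite [X in _ + X]big_nat_cond [X in _ + X]big1 ?addr0; last first.
  by move=> i /andP[/andP[ni _] _]; rewrite leqNgt ni mul0r.
by rewrite big_add1; apply: eq_big_nat => i /andP[_ hi]; rewrite hi.
Qed.

End DeterminantTrick.

Section ReesGenerators.
Variables (A : comNzRingType) (I : ideal A).

(** The monomial c t^k, with default 0 when [c] is outside the k-th power of [I]; being total, it
    can be used without carrying a membership proof. *)
Definition rmono (k : nat) (c : A) : rees I := insubd 0 (c *: 'X^k).

Lemma rmono_val k c : ideal_exp I k c -> rees_val (rmono k c) = c *: 'X^k.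
Proof.
move=> hc; apply: insubdK; apply/rees_predP => n; rewrite coefZ coefXn.
by case: eqP => [->|_]; rewrite ?mulr1 // mulr0; exact: ideal0.
Qed.

Fact rees_const_subproof c : c%:P \in rees_pred I.
Proof.
apply/rees_predP => -[|n]; first by [].
by rewrite coefC; exact: ideal0.
Qed.

Definition rees_const (c : A) : rees I := Rees (rees_const_subproof c).

Fact rees_const_additive : zmod_morphism rees_const.
Proof. by move=> a b; apply: val_inj; rewrite /= polyCB. Qed.

Fact rees_const_multiplicative : monoid_morphism rees_const.
Proof. by split=> [|a b]; apply: val_inj; rewrite //= polyCM. Qed.

HB.instance Definition _ :=
  GRing.isZmodMorphism.Build A (rees I) rees_const rees_const_additive.
HB.instance Definition _ :=
  GRing.isMonoidMorphism.Build A (rees I) rees_const rees_const_multiplicative.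

Lemma rees_monoE (p : rees I) :
  p = \sum_(i < size (rees_val p)) rmono i (rees_val p)`_i.
Proof.
apply: val_inj; apply: etrans (esym (rees_val_sum _ _)).
rewrite -[LHS]/(rees_val p) -[LHS]coefK poly_def; apply: eq_bigr => i _.
by rewrite rmono_val //; have /rees_predP := rees_valP p.
Qed.

(** Generation of the Rees algebra in degree 1, read off from the recursive definition of the powers
    of [I]. *)
Lemma rmonoS k c : ideal_exp I k.+1 c -> exists s : seq (A * A),
  (forall q, q \in s -> I q.1 /\ ideal_exp I k q.2) /\
  rmono k.+1 c = \sum_(q <- s) rmono 1 q.1 * rmono k q.2.
Proof.
move=> hc; have [s [hs cE]] := hc; exists s; split=> //.
apply: val_inj; apply: etrans (esym (rees_val_sum _ _)).
rewrite -[LHS]/(rees_val _) rmono_val // cE scaler_suml.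
rewrite big_seq [RHS]big_seq; apply: eq_bigr => q /hs[h1 h2].
rewrite -[RHS]/(rees_val _ * rees_val _) !rmono_val //; last exact: ideal_exp1.
by rewrite -scalerAl -scalerAr scalerA exprS.
Qed.

(** The closure properties of [Q] make the elements [a] of [I] with [Q (rmono 1 a)] an ideal, which
    contains [s] and therefore [I]. *)
Lemma rmono1_ind (s : seq A) (Q : rees I -> Prop) : generates s I ->
  Q 0 -> (forall x y, Q x -> Q y -> Q (x + y)) ->
  (forall r y, Q y -> Q (rees_const r * y)) ->
  (forall a, a \in s -> Q (rmono 1 a)) -> forall a, I a -> Q (rmono 1 a).
Proof.
move=> [sI Is] Q0 QD QM Qs.
have val1 a : I a -> rees_val (rmono 1 a) = a *: 'X.
  by move=> Ia; rewrite rmono_val //; exact: ideal_exp1.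
pose H : set A := [set a | I a /\ Q (rmono 1 a)].
have H0 : H 0.
  split; first exact: ideal0.
  have -> : rmono 1 0 = 0; last by [].
  by apply: val_inj; rewrite -[LHS]/(rees_val _) val1 ?scale0r //; exact: ideal0.
have HD x y : H x -> H y -> H (x + y).
  move=> [Ix Qx] [Iy Qy]; split; first exact: idealD.
  have -> : rmono 1 (x + y) = rmono 1 x + rmono 1 y; last exact: QD.
  apply: val_inj; rewrite -[LHS]/(rees_val _) -[RHS]/(rees_val _ + rees_val _).
  by rewrite !val1 ?scalerDl //; exact: idealD.
have HM r x : H x -> H (r * x).
  move=> [Ix Qx]; split; first exact: idealM.
  have -> : rmono 1 (r * x) = rees_const r * rmono 1 x; last exact: QM.
  apply: val_inj; rewrite -[LHS]/(rees_val _) -[RHS]/(rees_val _ * rees_val _).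
  by rewrite !val1 ?mul_polyC ?scalerA //; exact: idealM.
have hs y : y \in s -> H y by move=> ys; split; [exact: sI | exact: Qs].
by move=> a /(Is (Ideal H0 HD HM) hs)[].
Qed.

Lemma rmono_comp k c : ideal_exp I k c -> rees_comp k%:Z (rmono k c).
Proof.
move=> hc n nk; rewrite rmono_val // coefZ coefXn.
by move: nk; rewrite eqz_nat => /negbTE ->; rewrite mulr0.
Qed.

Lemma rees_noetherian : noetherian A -> noetherian (rees I).
Proof.
move=> noeth; have /finitely_generatedP[s sI] := noeth I.
apply: (@noetherian_algebra A _ rees_const [seq rmono 1 a | a <- s] noeth).
move=> P Pc Ps PD PM x.
have P0 : P 0 by rewrite -(rmorph0 rees_const); exact: Pc.
have P1 := rmono1_ind sI P0 PD (fun r y => PM _ _ (Pc r))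
  (fun a h => Ps _ (map_f _ h)).
have Pmono k c : ideal_exp I k c -> P (rmono k c).
  elim: k c => [|k IHk] c hc.
    have -> : rmono 0 c = rees_const c; last exact: Pc.
    by apply: val_inj; rewrite -[LHS]/(rees_val _) rmono_val //= alg_polyC.
  have [t [ht ->]] := rmonoS hc; rewrite big_seq; elim/big_ind: _ => //.
  by move=> q /ht[h1 h2]; apply: PM; [exact: P1 | exact: IHk].
rewrite (rees_monoE x); elim/big_ind: _ => // i _; apply: Pmono.
by have /rees_predP := rees_valP x.
Qed.

(* The zero element only serves to make this list of generators nonempty. *)
Definition rees_gens (s : seq A) : seq (rees_ring I) :=
  0 :: [seq rmono 1 a | a <- s].

Lemma rees_gens_irrelevant s :
  generates s I -> generates (rees_gens s) (irrelevant_ideal I).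
Proof.
move=> sI; have [h1 _] := sI; split=> [y|K hK p p0].
  rewrite inE => /orP[/eqP ->|/mapP[a /h1 Ia ->]]; first exact: irrelevant0.
  rewrite -[irrelevant_ideal I _]/((rees_val (rmono 1 a))`_0 = 0).
  by rewrite rmono_val ?coefZ ?coefX ?mulr0 //; exact: ideal_exp1.
have K1 := @rmono1_ind s K sI (ideal0 K) (@idealD _ K)
  (fun r y => @idealM _ K (rees_const r) y)
  (fun a h => hK _ (mem_behead (map_f (rmono 1) h : _ \in behead (rees_gens s)))).
rewrite (rees_monoE p); apply: ideal_sum => i _.
have hi : ideal_exp I i (rees_val p)`_i by have /rees_predP := rees_valP p.
case: (nat_of_ord i) hi => [|k] hk.
  have -> : rmono 0 (rees_val p)`_0 = 0; last exact: ideal0.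
  by apply: val_inj; rewrite -[LHS]/(rees_val _) rmono_val // p0 scale0r.
have [t [ht ->]] := rmonoS hk; apply: ideal_sum => q /ht[Iq _].
by rewrite mulrC; apply/idealM/K1.
Qed.

End ReesGenerators.

Theorem theorem1p2 (A : comNzRingType) (m I J : ideal A)
  (A_noetherian : noetherian A) (A_local : is_local m)
  (IJ : I `<=` J) (Jm : J `<=` m)
  (finite_length_JI : finite_length_quotient I J)
  (E : injective_resolution (rees_module IJ))
  (vanishing : forall i : nat, exists n0 : int, forall n : int, n0 <= n ->
     local_cohomology_vanishes (irrelevant_ideal I) E i n) :
  J `<=` integral_closure I.
Proof.
have /finitely_generatedP[s sI] := A_noetherian I.
have [h1 _] := sI.
have deg1 x : x \in rees_gens I s -> @gring_comp (rees_ring I) 1 x.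
  rewrite inE => /orP[/eqP ->|/mapP[a /h1 Ia ->]].
    exact: (homog0 (gring_grading (rees_ring I))).
  exact/(@rmono_comp _ I 1)/ideal_exp1.
have noethR : noetherian (rees_ring I) := rees_noetherian A_noetherian.
have [N hN] := eventually_generated noethR deg1
  (rees_gens_irrelevant sI) vanishing isT.
pose k := `|N|%N.
apply: (reduction_integral (k := k)); first exact: A_noetherian.
move=> z Jz.
(* For [x] = a t with [a] in [I], the coefficient of [x *: f] in degree [k.+1] is [a] times the k-th
   one of [f], which lies in the k-th power of [J]. Applied to z t^(k+1), [Q] is the required
   inclusion. *)
pose Q (f : rees_module IJ) := ideal_mul I (ideal_exp J k) (rees_val f)`_k.+1.
have : Q (rmono J k.+1 z).
  apply: (hN k.+1%:Z) => [|||u v Qu Qv|x f].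
  - by rewrite /k; lia.
  - exact: rmono_comp.
  - by rewrite /Q [(rees_val _)`_ _]coef0; exact: ideal0.
  - rewrite /Q -[rees_val (u + v)]/(rees_val u + rees_val v) coefD.
    exact: idealD.
  rewrite /Q -[rees_val (x *: f)]/(rees_val x * rees_val f).
  rewrite inE => /orP[/eqP ->|/mapP[a /h1 Ia ->]].
    by rewrite mul0r coef0; exact: ideal0.
  rewrite rmono_val; last exact: ideal_exp1.
  rewrite -scalerAl coefZ coefXM /=; apply: ideal_mulI => //.
  by have /rees_predP := rees_valP f.
by rewrite /Q rmono_val // coefZ coefXn eqxx mulr1.
Qed.
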